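(* Let $d\ge 3$ and $0<\alpha<2$. Let $(t(n))_{n\ge 1}$ be a non-decreasing sequence of positive real numbers with $\limsup_{n\to\infty} t(n)/n=\delta>0$, and let $$\mathcal{T}=\{(x',x_d)\in\mathbb{Z}^{d-1}\times\mathbb{Z}:\ \|x'\|\le t(x_d),\ x_d\ge 1\}.$$ Then $\mathcal{T}$ is massive with respect to the $\alpha$-stable random walk $S_\alpha$ on $\mathbb{Z}^d$.
   Context: $\|\cdot\|$ is the Euclidean norm. Let $\phi$ be the step distribution of the simple random walk on $\mathbb{Z}^d$ (uniform on the $2d$ vectors $\pm e_1,\dots,\pm e_d$) and let $\phi^{(n)}$ be its $n$-fold convolution power. For $0<\alpha<2$, the $\alpha$-stable random walk $S_\alpha=\{S_\alpha(n)\}_{n\ge 0}$ is the random walk on $\mathbb{Z}^d$ whose i.i.d. increments have law $\Phi_\alpha=\sum_{n\ge1}c(\psi_\alpha,n)\,\phi^{(n)}$, where $c(\psi_\alpha,n)=\frac{\alpha/2}{\Gamma(1-\alpha/2)}\frac{\Gamma(n-\alpha/2)}{\Gamma(n+1)}$; equivalently, if $P$ is the operator of convolution by $\phi$, the transition operator of $S_\alpha$ is $I-(I-P)^{\alpha/2}$. A proper subset $B\subset\mathbb{Z}^d$ is called massive (recurrent) with respect to a transient random walk if, for every starting point $x\in\mathbb{Z}^d$, the walk started at $x$ hits $B$ with probability $1$; otherwise it is non-massive. *)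

(* Defs.v *)
From HB Require Import structures.
From mathcomp Require Import all_boot all_order all_algebra.
From mathcomp Require Import all_classical all_reals all_analysis.
Set Implicit Arguments.
Unset Strict Implicit.
Unset Printing Implicit Defensive.
Import Order.TTheory GRing.Theory Num.Theory.
Import numFieldNormedType.Exports.
Local Open Scope classical_set_scope.
Local Open Scope ring_scope.

(* The lattice Z^d is 'rV[int]_d; e_i is delta_mx 0 i. *)

(* Euler's integral; only used at s > 0, where it converges. *)
Definition Gamma (R : realType) (s : R) : R :=
  \int[@lebesgue_measure R]_(x in `]0, +oo[) (x `^ (s - 1) * expR (- x)).

Definition unit_steps (d : nat) : set 'rV[int]_d :=
  [set z | exists i : 'I_d, z = delta_mx 0 i \/ z = - delta_mx 0 i].

Definition srw_law (R : realType) (d : nat) (z : 'rV[int]_d) : R :=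
  \1_(@unit_steps d) z / (2 * d)%:R.

(* The sum over all of Z^d is the finitely supported one: it is the true
   convolution whenever f or g has finite support, as is the case below. *)
Definition convolution (R : realType) (d : nat) (f g : 'rV[int]_d -> R)
    (z : 'rV[int]_d) : R :=
  \sum_(y \in [set: 'rV[int]_d]) f y * g (z - y).

Definition convolution_power (R : realType) (d : nat) (f : 'rV[int]_d -> R)
    (n : nat) : 'rV[int]_d -> R :=
  iter n (convolution f) (\1_[set 0]).

Definition stable_coef (R : realType) (alpha : R) (n : nat) : R :=
  (alpha / 2) / Gamma (1 - alpha / 2) *
  (Gamma (n%:R - alpha / 2) / Gamma (n.+1%:R)).

Definition stable_law (R : realType) (d : nat) (alpha : R) (z : 'rV[int]_d) :
    \bar R :=
  (\sum_(1 <= n <oo)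
     (stable_coef alpha n * convolution_power (@srw_law R d) n z)%:E)%E.

(* Z^d carries the discrete sigma-algebra, so that every subset of Z^d has a
   measurable preimage under a Z^d-valued random variable. *)
Record iid_with_law (R : realType) (disp : measure_display)
    (Omega : measurableType disp) (P : probability Omega R) (d : nat)
    (law : 'rV[int]_d -> \bar R) (xi : nat -> Omega -> 'rV[int]_d) : Prop := {
  iid_measurable : forall (k : nat) (A : set 'rV[int]_d),
    measurable (xi k @^-1` A);
  iid_law : forall (k : nat) (z : 'rV[int]_d),
    P (xi k @^-1` [set z]) = law z;
  iid_independent : forall (J : seq nat) (A : nat -> set 'rV[int]_d),
    uniq J ->
    P (\bigcap_(k in [set` J]) (xi k @^-1` A k)) =
    (\prod_(k <- J) P (xi k @^-1` A k))%E }.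

Definition walk (T : Type) (d : nat) (xi : nat -> T -> 'rV[int]_d)
    (x : 'rV[int]_d) (n : nat) (w : T) : 'rV[int]_d :=
  x + \sum_(k < n) xi k w.

(* xi is the sequence of increments of the walk. *)
Definition massive (R : realType) (disp : measure_display)
    (Omega : measurableType disp) (P : probability Omega R) (d : nat)
    (xi : nat -> Omega -> 'rV[int]_d) (B : set 'rV[int]_d) : Prop :=
  B <> setT /\
  forall x : 'rV[int]_d, P [set w | exists n : nat, B (walk xi x n w)] = 1%E.

Definition euclidean_norm (R : realType) (d : nat) (x : 'rV[int]_d) : R :=
  Num.sqrt (\sum_(i < d) ((x 0 i)%:~R) ^+ 2).

(* 'rV[int]_(m + 1) is Z^m x Z: a point x = (x', x_d), where d = m + 1, has
   x' = lsubmx x and x_d = rsubmx x 0 0. *)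
Definition thorn (R : realType) (m : nat) (t : nat -> R) :
    set 'rV[int]_(m + 1) :=
  [set x | exists n : nat,
     [/\ (1 <= n)%N, rsubmx x 0 0 = n%:Z &
         euclidean_norm R (lsubmx x) <= t n]].

(* Main.v *)
Require Import Defs.
From HB Require Import structures.
From mathcomp Require Import all_boot all_order all_algebra.
From mathcomp Require Import all_classical all_reals all_analysis.
From mathcomp Require Import measurable_realfun ring lra.
Import Order.TTheory GRing.Theory Num.Theory.
Import numFieldNormedType.Exports.
Set Implicit Arguments.
Unset Strict Implicit.
Unset Printing Implicit Defensive.
Local Open Scope classical_set_scope.
Local Open Scope ring_scope.

(** Write [b = alpha / 2], [Q] for the averaging operator of the simple random
walk and [r n = (1 - b) (1 - b / 2) ... (1 - b / n)].  The functional equation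
of [Gamma] gives [c(psi_alpha, n) = r (n - 1) - r n] up to a constant factor,
which is 1 because the increments have total mass 1: the stable walk is the
simple walk observed at times whose increments have tail [r].  Truncating the
sum over [n] at [J] turns the transition operator into a finite combination
[T J] of powers of [Q], at the price of a mass [r J] that tends to 0, so that
every estimate below is finite algebra with positive operators.

Two estimates describe [k] steps of the stable walk when [k] is of the order of
[1 / r N].  For an upper bound, [Q] raises [min (x_i ^ 2 / N) 1] by at most
[1 / N], hence [T J] raises it by at most [r N / (1 - b)] and after [k] steps a
coordinate is outside [(- sqrt N, sqrt N)] with probability at most
[k r N / (1 - b)].  For a lower bound, [cos (th x_i)] is an eigenfunction of
every [T J], with eigenvalue at most [1 - r N / 2] if [J >= N] and [N] is a
suitable multiple of [1 / th ^ 2]; after [k] steps its mean is small, which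
excludes that [x_i] is concentrated where the cosine exceeds [1 / 2]
([stable_exit_le], [stable_spread_ge]).  Since [r (2 ^ j N) / r N] tends to 0
as [j] grows, uniformly in [N], one step count [k] serves both purposes: the
walk is outside a tube of width a large constant times [2 ^ s] with a small
probability, and its vertical coordinate has moved by [2 ^ s] with a fixed one.
The law is invariant under the [2 ^ d] changes of signs of the coordinates, and
for each displacement one of them points upwards and brings the walk back
towards the axis of the tube.  So the walk ends up in the tube and [2 ^ s]
higher with a probability bounded below, uniformly in [s] and in the starting
point of the tube ([stable_steer]).

The thorn contains, for infinitely many [n], a half-infinite tube that starts at
height [n] and has a radius proportional to [n].  With [2 ^ s] proportional to
[n], a bounded number of climbs leads into it: from every point the thorn is hit
with a probability at least some [p > 0] ([avoidance_bound]).  Finally let [u]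
be the probability of never hitting, as a function of the starting point.  If
[u <= q] everywhere then, conditioning on the position at time [N], [u] is at
most [q] times the probability of not hitting up to time [N], and [N] tending
to infinity gives [u <= q u]; with [q = 1 - p < 1] this forces [u = 0]
([avoid_cvg0]). *)

(** * The Sibuya law *)

Section Sibuya.
Context {R : realType}.
Variable b : R.
Hypotheses (b0 : 0 < b) (b1 : b < 1).

(** The tail of the Sibuya law, that is, of the first success among independent
trials of which the [k]-th succeeds with probability [b / k]. *)
Definition sibuya_tail (n : nat) : R := \prod_(k < n) (1 - b / k.+1%:R).
Local Notation r := sibuya_tail.

Lemma sibuya_tail0 : r 0 = 1.
Proof. by rewrite /r big_ord0. Qed.

Lemma sibuya_tailS n : r n.+1 = r n * (1 - b / n.+1%:R).
Proof. by rewrite /r big_ord_recr. Qed.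

Lemma sibuya_factor_gt0 n : 0 < 1 - b / n.+1%:R.
Proof.
rewrite subr_gt0 ltr_pdivrMr ?ltr0n// mul1r (lt_le_trans b1)//.
by rewrite ler1n.
Qed.

Lemma sibuya_tail_gt0 n : 0 < r n.
Proof. by apply: prodr_gt0 => k _; exact: sibuya_factor_gt0. Qed.

Lemma sibuya_tail_sub n : r n - r n.+1 = b / n.+1%:R * r n.
Proof. by rewrite sibuya_tailS; ring. Qed.

Lemma sibuya_mass_ge0 n : 0 <= r n - r n.+1.
Proof.
rewrite sibuya_tail_sub mulr_ge0 ?divr_ge0 ?(ltW b0)//.
exact/ltW/sibuya_tail_gt0.
Qed.

Lemma sibuya_tail_noninc m n : (m <= n)%N -> r n <= r m.
Proof.
move=> /subnK <-; elim: (n - m)%N => [//|k IH].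
by rewrite addSn (le_trans _ IH)// -subr_ge0 sibuya_mass_ge0.
Qed.

Lemma sibuya_tail_le1 n : r n <= 1.
Proof. by rewrite -sibuya_tail0 sibuya_tail_noninc. Qed.

Lemma sum_sibuya_mass n : \sum_(j < n) (r j - r j.+1) = 1 - r n.
Proof.
elim: n => [|n IH]; first by rewrite big_ord0 sibuya_tail0 subrr.
by rewrite big_ord_recr/= IH; ring.
Qed.

(** The mean of [min (tau / N) 1] under the Sibuya law.  By Abel summation it is
the average of the tails [r 0, ..., r (N - 1)], whose sum telescopes to
[N * r N / (1 - b)]. *)
Lemma sibuya_truncated_mean N J : (0 < N)%N ->
  \sum_(j < J) (r j - r j.+1) * Num.min (j.+1%:R / N%:R) 1 <= r N / (1 - b).
Proof.
move=> N0.
have N0' : 0 < N%:R :> R by rewrite ltr0n.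
have c0 : 0 < 1 - b by rewrite subr_gt0.
set a : nat -> R := fun j => Num.min (j%:R / N%:R) 1.
pose V J := \sum_(j < J) (r j - r j.+1) * a j.+1 + r J * a J.
have VS j : V j.+1 = V j + r j * (a j.+1 - a j).
  by rewrite /V big_ord_recr/=; ring.
have aE j : (j <= N)%N -> a j = j%:R / N%:R.
  by move=> jN; rewrite /a min_l// ler_pdivrMr// mul1r ler_nat.
have aN j : (N <= j)%N -> a j = 1.
  by move=> jN; rewrite /a min_r// ler_pdivlMr// mul1r ler_nat.
have V1 j : (j <= N)%N -> V j = j%:R / N%:R * (r j / (1 - b)).
  elim: j => [_|j IH jN]; first by rewrite /V big_ord0 aE//; ring.
  rewrite VS IH 1?ltnW// aE// aE 1?ltnW// sibuya_tailS.
  have j0 : j.+1%:R != 0 :> R by rewrite pnatr_eq0.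
  have c0' := lt0r_neq0 c0; have N0'' := lt0r_neq0 N0'.
  move: j0; rewrite -!natr1; move: (j%:R) (r j) (N%:R) N0'' => x y z z0 x0.
  by field; rewrite x0 c0' z0.
have V2 k : V (N + k)%N = r N / (1 - b).
  elim: k => [|k IH].
    by rewrite addn0 V1// divff ?mul1r// lt0r_neq0.
  by rewrite addnS VS IH !aN ?leqW ?leq_addr// subrr mulr0 addr0.
have VN : forall j, V J <= V (j + J)%N; last first.
  rewrite -(V2 J) (le_trans _ (VN N))//.
  rewrite /V lerDl mulr_ge0 ?(ltW (sibuya_tail_gt0 _))//.
  rewrite /a le_min ler01 divr_ge0//.
elim=> [//|k IH]; rewrite addSn VS (le_trans IH)// lerDl.
rewrite mulr_ge0 ?(ltW (sibuya_tail_gt0 _))// subr_ge0 /a le_min !ge_min lexx.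
by rewrite orbT andbT ler_wpM2r ?invr_ge0 ?ler_nat.
Qed.

(** Regular variation in the weak form needed here: each doubling of the range
costs a fixed factor [1 + b / 2], because the harmonic sum over a dyadic block
is at least [1 / 2]. *)
Lemma sibuya_tail_decay s N : (0 < N)%N ->
  r (2 ^ s * N) * (1 + s%:R * (b / 2)) <= r N.
Proof.
move=> N0.
(* Each new factor is at most [1 - b / (2 * M)], and
   [(1 - x) * (1 + y + z) <= 1 + y] as soon as [z <= x] and [0 <= y, z]. *)
have half M k : (0 < M)%N -> (k <= M)%N ->
    r (M + k) * (1 + b * k%:R / (2 * M)%:R) <= r M.
  move=> M0; elim: k => [|k IH] kM.
    by rewrite addn0 !(mulr0, mul0r) addr0 mulr1.
  apply: le_trans (IH (ltnW kM)); rewrite addnS sibuya_tailS -mulrA.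
  rewrite ler_wpM2l ?(ltW (sibuya_tail_gt0 _))//.
  set y := b * k%:R / _; set x := b / _.
  have x0 : 0 <= x by rewrite divr_ge0// ltW.
  have y0 : 0 <= y by rewrite divr_ge0// mulr_ge0// ltW.
  have -> : b * k.+1%:R / (2 * M)%:R = y + b / (2 * M)%:R.
    by rewrite /y -natr1; ring.
  have xz : b / (2 * M)%:R <= x.
    rewrite /x ler_wpM2l ?(ltW b0)// lef_pV2 ?posrE ?ltr0n ?muln_gt0// ler_nat.
    by rewrite mul2n -addnn -addnS leq_add2l.
  have z0 : 0 <= b / (2 * M)%:R by rewrite divr_ge0// ltW.
  by nra.
elim: s => [|s IH]; first by rewrite expn0 mul1n mul0r addr0 mulr1.
have M0 : (0 < 2 ^ s * N)%N by rewrite muln_gt0 expn_gt0.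
have := half _ _ M0 (leqnn _).
rewrite addnn -mul2n.
have -> : b * (2 ^ s * N)%:R / (2 * (2 ^ s * N))%:R = b / 2 :> R.
  rewrite (natrM _ 2).
  have : (2 ^ s * N)%:R != 0 :> R by rewrite pnatr_eq0 -lt0n.
  by move: (_%:R) => y y0; field.
rewrite mulnA -expnS => H; apply: le_trans IH.
have s0 : 0 <= s%:R * (b / 2) by rewrite mulr_ge0// divr_ge0// ltW.
apply: (@le_trans _ _ (r (2 ^ s.+1 * N) * (1 + b / 2) * (1 + s%:R * (b / 2)))).
  rewrite -mulrA ler_wpM2l ?(ltW (sibuya_tail_gt0 _))//.
  rewrite -subr_ge0 -natr1.
  rewrite (_ : _ - _ = (b / 2) * (s%:R * (b / 2))); last by ring.
  by rewrite mulr_ge0// divr_ge0// ltW.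
by rewrite ler_wpM2r// addr_ge0.
Qed.

Lemma sibuya_tail_small e : 0 < e -> exists N, forall n, (N <= n)%N -> r n <= e.
Proof.
move=> e0.
have b2 : 0 < b / 2 by rewrite divr_gt0.
pose s := Num.bound ((e * (b / 2))^-1).
exists (2 ^ s)%N => n /sibuya_tail_noninc/le_trans; apply.
have := @sibuya_tail_decay s 1 isT; rewrite muln1 => H.
have sb : (e * (b / 2))^-1 < s%:R.
  by apply: archi_boundP; rewrite invr_ge0 mulr_ge0 ?ltW.
have {sb} : 1 < s%:R * (b / 2) * e.
  rewrite -mulrA [b / 2 * e]mulrC.
  by rewrite -ltr_pdivrMr ?mulr_gt0// mul1r.
have := sibuya_tail_le1 1; have := sibuya_tail_gt0 (2 ^ s)%N.
by nra.
Qed.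

End Sibuya.

Lemma bernoulli_contraction {R : realType} (x : R) n : 0 <= x <= 1 ->
  (1 - x) ^+ n * (1 + n%:R * x) <= 1.
Proof.
move=> /andP[x0 x1]; elim: n => [|n IH].
  by rewrite expr0 mul0r addr0 mulr1.
apply: le_trans IH; rewrite exprS mulrAC mulrC ler_wpM2l ?exprn_ge0 ?subr_ge0//.
have : 0 <= n%:R * x by rewrite mulr_ge0.
by rewrite -natr1; nra.
Qed.

(** * Positive operators and the simple random walk *)

Section PositiveOperators.
Context {R : realType} {V : Type}.
Implicit Types (A : (V -> R) -> V -> R) (f g : V -> R).

(** Only finite combinations of functions occur, so that positivity and
linearity replace integration against a kernel. *)
Record positive_operator A : Prop := {
  pos_linear : forall a f g x,
    A (fun y => a * f y + g y) x = a * A f x + A g x;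
  pos_monotone : forall f g, (forall y, f y <= g y) ->
    forall x, A f x <= A g x }.

Section Theory.
Variable A : (V -> R) -> V -> R.
Hypothesis posA : positive_operator A.

Lemma pos_add f g x : A (fun y => f y + g y) x = A f x + A g x.
Proof.
rewrite -[A f x]mul1r -(pos_linear posA); congr (A _ x).
by apply/funext => y; rewrite mul1r.
Qed.

Lemma pos_zero x : A (fun=> 0) x = 0.
Proof.
have := pos_add (fun=> 0) (fun=> 0) x; rewrite addr0.
by move=> /(congr1 (fun z => z - A (fun=> 0) x)); rewrite addrK subrr.
Qed.

Lemma pos_scale a f x : A (fun y => a * f y) x = a * A f x.
Proof.
rewrite -[RHS]addr0 -(pos_zero x) -(pos_linear posA); congr (A _ x).
by apply/funext => y; rewrite addr0.
Qed.

Lemma pos_const a x : A (fun=> a) x = a * A (fun=> 1) x.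
Proof.
by rewrite -pos_scale; congr (A _ x); apply/funext => y; rewrite mulr1.
Qed.

Lemma pos_sum (I : Type) (s : seq I) (F : I -> V -> R) x :
  A (fun y => \sum_(i <- s) F i y) x = \sum_(i <- s) A (F i) x.
Proof.
elim: s => [|i s IH].
  rewrite big_nil -[RHS](pos_zero x); congr (A _ x).
  by apply/funext => y; rewrite big_nil.
rewrite big_cons -IH -pos_add; congr (A _ x).
by apply/funext => y; rewrite big_cons.
Qed.

Lemma pos_ge0 f x : (forall y, 0 <= f y) -> 0 <= A f x.
Proof. by move=> f0; rewrite -(pos_zero x); exact: pos_monotone. Qed.

Lemma pos_iter k : positive_operator (iter k A).
Proof.
elim: k => [|k IH]; first by split.
split=> [a f g x|f g fg x] /=.
  rewrite -(pos_linear posA); congr (A _ x).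
  by apply/funext => y; exact: (pos_linear IH).
by apply: (pos_monotone posA) => y; exact: (pos_monotone IH).
Qed.

Lemma pos_iter_eigen g a k x : (forall y, A g y = a * g y) ->
  iter k A g x = a ^+ k * g x.
Proof.
move=> Ag; elim: k x => [x|k IH x]; first by rewrite mul1r.
rewrite iterS exprS (_ : iter k A g = fun y => a ^+ k * g y).
  by rewrite pos_scale Ag; ring.
by apply/funext.
Qed.

Lemma pos_iter_drift f e k x : (forall y, A (fun=> 1) y <= 1) -> 0 <= e ->
  (forall y, A f y <= f y + e) -> iter k A f x <= f x + k%:R * e.
Proof.
move=> A1 e0 Af; elim: k x => [x|k IH x]; first by rewrite mul0r addr0.
apply: (@le_trans _ _ (A (fun y => f y + k%:R * e) x)).
  exact: (pos_monotone posA).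
rewrite pos_add (pos_const (k%:R * e)) -natr1 mulrDl mul1r addrA.
rewrite [f x + _ + _]addrAC lerD//.
by rewrite -[leRHS]mulr1 ler_wpM2l// mulr_ge0.
Qed.

Lemma pos_iter_subharmonic f e k x : (forall y, A (fun=> 1) y <= 1) -> 0 <= e ->
  (forall y, f y <= A f y + e) -> f x <= iter k A f x + k%:R * e.
Proof.
move=> A1 e0 Af; elim: k x => [x|k IH x]; first by rewrite mul0r addr0.
apply: (le_trans (Af x)); rewrite -natr1 mulrDl mul1r addrA lerD2r /=.
apply: (@le_trans _ _ (A (fun y => iter k A f y + k%:R * e) x)).
  exact: (pos_monotone posA).
rewrite pos_add (pos_const (k%:R * e)) lerD2l.
by rewrite -[leRHS]mulr1 ler_wpM2l// mulr_ge0.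
Qed.

Definition equivariant (s : V -> V) := forall f x,
  A (fun y => f (s y)) x = A f (s x).

Lemma equivariant_iter s k : equivariant s -> forall f x,
  iter k A (fun y => f (s y)) x = iter k A f (s x).
Proof.
move=> eqs f; elim: k => [//|k IH x] /=; rewrite -eqs; congr (A _ x).
exact/funext.
Qed.

End Theory.

Lemma pos_nneg_sum (I : Type) (s : seq I) (c : I -> R)
    (A : I -> (V -> R) -> V -> R) :
  (forall i, 0 <= c i) -> (forall i, positive_operator (A i)) ->
  positive_operator (fun f x => \sum_(i <- s) c i * A i f x).
Proof.
move=> c0 posA; split=> [a f g x|f g fg x].
  rewrite mulr_sumr -big_split/=; apply: eq_bigr => i _.
  by rewrite (pos_linear (posA i)); ring.
apply: ler_sum => i _; apply: ler_wpM2l => //.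
exact: (pos_monotone (posA i)).
Qed.

Lemma equivariant_sum (I : Type) (s : seq I) (c : I -> R)
    (A : I -> (V -> R) -> V -> R) (h : V -> V) :
  (forall i, equivariant (A i) h) ->
  equivariant (fun f x => \sum_(i <- s) c i * A i f x) h.
Proof. by move=> eqA f x; apply: eq_bigr => i _; rewrite eqA. Qed.

End PositiveOperators.

Section Lattice.
Context {R : realType} {d : nat}.
Hypothesis d0 : (0 < d)%N.
Local Notation V := 'rV[int]_d.
Local Notation e i := (delta_mx 0 i : V).
Implicit Types (f g : V -> R) (x y : V).

Definition srw_step f x : R :=
  (\sum_(i < d) (f (x + e i) + f (x - e i))) / (2 * d)%:R.

Lemma srw_step_positive : positive_operator srw_step.
Proof.
split=> [a f g x|f g fg x]; rewrite /srw_step.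
  rewrite !mulr_suml mulr_sumr -big_split/=; apply: eq_bigr => i _.
  by ring.
by apply: ler_wpM2r; rewrite ?invr_ge0//; apply: ler_sum => i _; exact: lerD.
Qed.

Let dR : (2 * d)%:R != 0 :> R.
Proof. by rewrite pnatr_eq0 -lt0n muln_gt0. Qed.

Lemma srw_step1 x : srw_step (fun=> 1) x = 1.
Proof.
by rewrite /srw_step sumr_const card_ord -mulr2n -mulrnA mulfV.
Qed.

Lemma srw_step_coord (h : int -> R) i x :
  srw_step (fun y => h (y 0 i)) x = h (x 0 i) +
  (h (x 0 i + 1) + h (x 0 i - 1) - 2 * h (x 0 i)) / (2 * d)%:R.
Proof.
rewrite /srw_step (bigD1 i)//= !mxE !eqxx/=.
under eq_bigr => j ji.
  rewrite !mxE eqxx/= [i == j]eq_sym (negPf ji) oppr0 addr0; over.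
rewrite sumr_const.
have -> : #|[pred j | j != i]| = d.-1.
  by have := cardC1 i; rewrite card_ord.
have -> : (h (x 0 i) + h (x 0 i)) *+ d.-1 =
    (2 * d)%:R * h (x 0 i) - 2 * h (x 0 i).
  have dE : d%:R = d.-1%:R + 1 :> R by rewrite natr1 prednK.
  by rewrite -mulr_natl natrM dE; ring.
by move: dR; move: ((2 * d)%:R) => D D0; field.
Qed.

Definition ramp N i x : R := Num.min (((x 0 i)%:~R) ^+ 2 / N%:R) 1.

Lemma ramp_ge0 N i x : 0 <= ramp N i x.
Proof. by rewrite le_min ler01 divr_ge0 ?sqr_ge0. Qed.

Lemma ramp_le1 N i x : ramp N i x <= 1.
Proof. by rewrite ge_min lexx orbT. Qed.

(** The square has discrete second difference 2, and capping it at 1 can only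
lower the neighbours: where the cap is active the increment is nonpositive. *)
Lemma srw_step_ramp N i x : (0 < N)%N ->
  srw_step (ramp N i) x <= ramp N i x + N%:R^-1.
Proof.
move=> N0; have N0' : 0 < N%:R :> R by rewrite ltr0n.
pose q (z : int) : R := Num.min ((z%:~R) ^+ 2 / N%:R) 1.
rewrite (srw_step_coord q) lerD2l ler_pdivrMr ?ltr0n ?muln_gt0//.
set z := x 0 i.
have q1 (y : int) : q y <= 1 by rewrite ge_min lexx orbT.
have qs (y : int) : q y <= y%:~R ^+ 2 / N%:R by rewrite ge_min lexx.
have d2 : 2 / N%:R <= N%:R^-1 * (2 * d)%:R :> R.
  by rewrite mulrC ler_wpM2l ?invr_ge0// ler_nat leq_pmulr.
apply: le_trans d2.
have := q1 (z + 1); have := q1 (z - 1); have := qs (z + 1); have := qs (z - 1).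
rewrite !intrD mulrN1z !mulr1z.
have [zN|zN] := leP ((z%:~R : R) ^+ 2 / N%:R) 1.
  have -> : q z = z%:~R ^+ 2 / N%:R by rewrite /q min_l.
  move=> h1 h2 _ _.
  have -> : 2 / N%:R = (z%:~R + 1) ^+ 2 / N%:R + (z%:~R - 1) ^+ 2 / N%:R -
    2 * (z%:~R ^+ 2 / N%:R) :> R by ring.
  by rewrite lerD2r lerD.
have -> : q z = 1 by rewrite /q min_r// ltW.
move=> _ _ h1 h2.
have : 0 <= 2 / N%:R :> R by rewrite divr_ge0.
by lra.
Qed.

Definition cosine th i x : R := cos (th * (x 0 i)%:~R).

Lemma srw_step_cosine th i x :
  srw_step (cosine th i) x = (1 - (1 - cos th) / d%:R) * cosine th i x.
Proof.
rewrite (srw_step_coord (fun z => cos (th * z%:~R))) /cosine.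
rewrite !intrD mulrN1z !mulr1z mulrDr mulrBr mulr1 cosD cosB.
have : d%:R != 0 :> R by rewrite pnatr_eq0 -lt0n.
move: (cos (_ * _)) (sin (_ * _)) (cos th) (sin th) => c1 s1 c s.
by rewrite natrM => D0; field.
Qed.

Definition flip (S : {set 'I_d}) x : V :=
  \row_i (if i \in S then - x 0 i else x 0 i).

Lemma flipD S : {morph flip S : x y / x + y}.
Proof.
by move=> x y; apply/rowP => i; rewrite !mxE; case: ifP; rewrite ?opprD.
Qed.

Lemma flip_delta S i : flip S (e i) = if i \in S then - e i else e i.
Proof.
apply/rowP => j; rewrite mxE.
case: ifPn => jS; case: ifPn => iS; rewrite !mxE//=.
all: by case: eqP => // ji; move: jS; rewrite ji ?iS ?(negPf iS).
Qed.

Lemma flipN S : {morph flip S : x / - x}.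
Proof. by move=> x; apply/rowP => i; rewrite !mxE; case: ifP. Qed.

Lemma srw_step_flip S : equivariant srw_step (flip S).
Proof.
move=> f x; congr (_ / _); apply: eq_bigr => i _.
rewrite !flipD flipN flip_delta; case: ifP => // _.
by rewrite opprK addrC.
Qed.

Lemma srw_step_shift y : equivariant srw_step (fun x => y + x).
Proof.
by move=> f x; congr (_ / _); apply: eq_bigr => i _; rewrite !addrA.
Qed.

End Lattice.

(** * The truncated stable step *)

Section DyadicAngle.
Context {R : realType}.

(** Frequencies are restricted to halvings of one angle, so that the lower bound
on [1 - cos] follows from the doubling formula alone. *)
Definition dyadic_angle s : R := acos (1 / 2) / 2 ^+ s.

Let half_itv : -1 <= (1 / 2 : R) <= 1.
Proof. by lra. Qed.

Lemma cos_dyadic_angle s : (2 * 4 ^+ s)^-1 <= 1 - cos (dyadic_angle s).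
Proof.
elim: s => [|s IH].
  by rewrite /dyadic_angle expr0 divr1 acosK ?in_itv//= mulr1; lra.
have D : dyadic_angle s = dyadic_angle s.+1 *+ 2.
  rewrite /dyadic_angle exprS -mulr_natl.
  have : (2 : R) ^+ s != 0 by rewrite expf_neq0.
  by move: (2 ^+ s) => y y0; field.
move: IH; rewrite D cos_mulr2n (exprS 4).
have := cos_le1 (dyadic_angle s.+1); have := cos_geN1 (dyadic_angle s.+1).
move: (cos _) => c c1 c2.
have y0 : (2 * 4 ^+ s : R) != 0 by rewrite mulf_neq0// expf_neq0.
have -> : (2 * (4 * 4 ^+ s))^-1 = (2 * 4 ^+ s)^-1 / 4 :> R.
  by rewrite mulrCA invfM mulrC.
move: (_^-1) => z; rewrite mulr2n expr2; nra.
Qed.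

Lemma cos_dyadic_angle_ge s (z : int) : `|z| <= 2 ^+ s ->
  1 / 2 <= cos (dyadic_angle s * z%:~R).
Proof.
move=> zs; rewrite -[leLHS](acosK (x := 1 / 2)) ?in_itv//=.
have a0 : 0 <= acos (1 / 2 : R) by apply: acos_ge0.
have api : acos (1 / 2 : R) <= pi by apply: acos_lepi.
have zle : `|dyadic_angle s * z%:~R| <= acos (1 / 2 : R).
  rewrite normrM /dyadic_angle ger0_norm ?divr_ge0 ?exprn_ge0//.
  rewrite -[leRHS]mulr1 -mulrA ler_wpM2l// mulrC ler_pdivrMr ?exprn_gt0// mul1r.
  by rewrite -intr_norm -(ler_int R) in zs *; rewrite (le_trans zs)// rmorphXn.
rewrite -[leRHS]cos_norm leNgt.
rewrite ltr_cos ?in_itv/= ?a0 ?normr_ge0 ?(le_trans zle)//.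
by rewrite -leNgt.
Qed.
End DyadicAngle.

Section StableStep.
Context {R : realType} {d : nat}.
Hypothesis d1 : (1 < d)%N.
Let d0 : (0 < d)%N := ltnW d1.
Local Notation V := 'rV[int]_d.
Implicit Types (f g : V -> R) (x y : V).
Variable b : R.
Hypotheses (b0 : 0 < b) (b1 : b < 1).
Local Notation r := (sibuya_tail b).

(** The transition operator of the stable walk, killed when the subordinator
jumps by more than [J]. *)
Definition stable_step J f x : R :=
  \sum_(j < J) (r j - r j.+1) * iter j.+1 srw_step f x.

Lemma stable_step_positive J : positive_operator (stable_step J).
Proof.
apply: pos_nneg_sum => [j|j]; first exact: sibuya_mass_ge0.
exact: (pos_iter (@srw_step_positive R d) j.+1).
Qed.

Lemma stable_step_flip S J : equivariant (stable_step J) (flip S).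
Proof.
apply: equivariant_sum => j; apply: equivariant_iter.
exact: srw_step_flip.
Qed.

Lemma stable_step_shift y J : equivariant (stable_step J) (fun x => y + x).
Proof.
apply: equivariant_sum => j; apply: equivariant_iter.
exact: srw_step_shift.
Qed.

Lemma iter_srw_step1 j x : iter j (@srw_step R d) (fun=> 1) x = 1.
Proof.
rewrite (pos_iter_eigen (@srw_step_positive R d) (a := 1)) ?expr1n ?mulr1//.
by move=> y; rewrite srw_step1// mulr1.
Qed.

Lemma stable_step1 J x : stable_step J (fun=> 1) x = 1 - r J.
Proof.
rewrite -(sum_sibuya_mass b J); apply: eq_bigr => j _.
by rewrite iter_srw_step1 mulr1.
Qed.

Lemma stable_step_le1 J x : stable_step J (fun=> 1) x <= 1.
Proof. by rewrite stable_step1 gerBl ltW// sibuya_tail_gt0. Qed.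

(** After [j] steps of the simple walk the ramp has grown by at most
[min (j / N) 1]; the average of this bound over the subordinator is
[sibuya_truncated_mean]. *)
Lemma stable_step_ramp J N i x : (0 < N)%N ->
  stable_step J (ramp N i) x <= ramp N i x + r N / (1 - b).
Proof.
move=> N0.
apply: (@le_trans _ _ (\sum_(j < J) (r j - r j.+1) *
    (ramp N i x + Num.min (j.+1%:R / N%:R) 1))).
  apply: ler_sum => j _; rewrite ler_wpM2l ?sibuya_mass_ge0//.
  rewrite minElt; case: ifPn => _.
    apply: pos_iter_drift; rewrite ?invr_ge0//.
    - exact: srw_step_positive.
    - by move=> y; rewrite srw_step1.
    - by move=> y; exact: srw_step_ramp.
  rewrite -[leLHS]add0r lerD ?ramp_ge0//.
  rewrite -(iter_srw_step1 j.+1 x).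
  apply: (pos_monotone (pos_iter (@srw_step_positive R d) j.+1)) => y.
  exact: ramp_le1.
under eq_bigr do rewrite mulrDr.
rewrite big_split/= -mulr_suml sum_sibuya_mass lerD//; last first.
  exact: sibuya_truncated_mean.
by rewrite -[leRHS]mul1r ler_wpM2r ?ramp_ge0// gerBl ltW// sibuya_tail_gt0.
Qed.

(** The eigenvalue of [stable_step] on a cosine. *)
Definition stable_freq J th : R :=
  \sum_(j < J) (r j - r j.+1) * (1 - (1 - cos th) / d%:R) ^+ j.+1.

Lemma stable_step_cosine J th i x :
  stable_step J (cosine th i) x = stable_freq J th * cosine th i x.
Proof.
rewrite /stable_step /stable_freq mulr_suml; apply: eq_bigr => j _.
rewrite -mulrA; congr (_ * _); apply: pos_iter_eigen.
  exact: srw_step_positive.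
by move=> y; exact: srw_step_cosine.
Qed.

Lemma srw_freq_itv th : 0 <= (1 - cos th) / d%:R <= (1 : R).
Proof.
rewrite divr_ge0 ?subr_ge0 ?cos_le1//= ler_pdivrMr ?ltr0n// mul1r.
apply: (@le_trans _ _ 2); last by rewrite ler_nat.
by have := cos_geN1 th; lra.
Qed.

Lemma stable_freq_ge0 J th : 0 <= stable_freq J th.
Proof.
apply: sumr_ge0 => j _; rewrite mulr_ge0 ?sibuya_mass_ge0 ?exprn_ge0// subr_ge0.
by have /andP[] := srw_freq_itv th.
Qed.

(** Subordinator jumps longer than [N], which have probability about [r N],
at least halve the cosine. *)
Lemma stable_freq_le J N th : (N <= J)%N -> d%:R <= N%:R * (1 - cos th) ->
  stable_freq J th <= 1 - r N / 2.
Proof.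
move=> NJ Nth; set x := (1 - cos th) / d%:R.
have /andP[x0 x1] : 0 <= x <= 1 by exact: srw_freq_itv.
have rN : (1 - x) ^+ N <= 1 / 2.
  have Nx : 1 <= N%:R * x by rewrite mulrA ler_pdivlMr ?ltr0n// mul1r.
  have := @bernoulli_contraction R x N; rewrite x0 x1 => /(_ isT).
  have : 0 <= (1 - x) ^+ N by rewrite exprn_ge0// subr_ge0.
  by move: (_ ^+ _) => y y0; nra.
have -> : stable_freq J th = \sum_(0 <= j < J) (r j - r j.+1) * (1 - x) ^+ j.+1.
  by rewrite big_mkord.
rewrite (big_cat_nat (n := N))//=.
have -> : 1 - r N / 2 = (1 - r N) + r N * (1 / 2) by field.
rewrite lerD//.
  rewrite -(sum_sibuya_mass b N) big_mkord; apply: ler_sum => j _.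
  rewrite -[leRHS]mulr1 ler_wpM2l ?sibuya_mass_ge0// exprn_ile1 ?subr_ge0//.
  by rewrite gerBl.
apply: (@le_trans _ _ (\sum_(N <= j < J) (r j - r j.+1) * (1 / 2))).
  apply: ler_sum_nat => j /andP[Nj _].
  rewrite ler_wpM2l ?sibuya_mass_ge0// (le_trans _ rN)//.
  by rewrite ler_wiXn2l ?subr_ge0 ?gerBl// leqW.
rewrite -mulr_suml ler_wpM2r// (@telescope_sumr_eq _ N J (fun j => - r j))//.
  by rewrite opprK addrC gerBl ltW// sibuya_tail_gt0.
by move=> j _; rewrite opprK addrC.
Qed.
End StableStep.

(** * Spread and exit at the natural time scale *)

Section Spread.
Context {R : realType} {d : nat}.
Hypothesis d1 : (1 < d)%N.
Let d0 : (0 < d)%N := ltnW d1.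
Local Notation V := 'rV[int]_d.
Implicit Types (f g : V -> R) (x y : V).
Variable b : R.
Hypotheses (b0 : 0 < b) (b1 : b < 1).
Local Notation r := (sibuya_tail b).
Local Notation T J := (@stable_step R d b J).

Lemma iter_stable_step1_le J k x : iter k (T J) (fun=> 1) x <= 1.
Proof.
have := @pos_iter_drift _ _ _ (stable_step_positive b0 b1 J) (fun=> 1) 0 k x.
rewrite mulr0 addr0; apply=> // y; rewrite ?addr0; exact: stable_step_le1.
Qed.

Lemma iter_stable_step1_ge J k x : 1 - k%:R * r J <= iter k (T J) (fun=> 1) x.
Proof.
rewrite lerBlDr.
apply: (@pos_iter_subharmonic _ _ _ (stable_step_positive b0 b1 J) (fun=> 1)).
- by move=> y; exact: stable_step_le1.
- exact/ltW/sibuya_tail_gt0.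
- by move=> y; rewrite stable_step1// subrK.
Qed.

Lemma stable_exit_le J k N i : (0 < N)%N ->
  iter k (T J) (fun y => (N%:R <= ((y 0 i)%:~R : R) ^+ 2)%R%:R) 0 <=
  k%:R * (r N / (1 - b)).
Proof.
move=> N0; have N0' : 0 < N%:R :> R by rewrite ltr0n.
apply: (@le_trans _ _ (iter k (T J) (ramp N i) 0)).
  apply: (pos_monotone (pos_iter (stable_step_positive b0 b1 J) k)) => y.
  case: (leP N%:R) => [Ny|_]; last exact: ramp_ge0.
  by rewrite le_min lexx andbT ler_pdivlMr// mul1r.
have r0 : ramp N i 0 = 0 :> R by rewrite /ramp mxE expr0n mul0r min_l.
rewrite -[leRHS]add0r -r0; apply: pos_iter_drift.
- exact: stable_step_positive.
- by move=> y; exact: stable_step_le1.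
- by rewrite divr_ge0 ?subr_ge0 ?ltW// sibuya_tail_gt0.
- by move=> y; exact: stable_step_ramp.
Qed.

(** The mean of the cosine after [k] steps is at most [1 / 8], whereas it would
be close to at least [1 / 2] if the coordinate stayed within [2 ^ s]. *)
Lemma stable_spread_ge J k s i : (2 * d * 4 ^ s <= J)%N ->
  14 <= k%:R * r (2 * d * 4 ^ s) ->
  1 / 4 - k%:R * r J / 3 <=
  iter k (T J) (fun y => (2 ^+ s < `|y 0 i|)%R%:R) 0.
Proof.
set N := (2 * d * 4 ^ s)%N => NJ kN.
pose th : R := dyadic_angle s.
have posT := @stable_step_positive R d b b0 b1 J.
set F := fun y => _.
have freq : @stable_freq R d b J th ^+ k <= 1 / 8.
  have fle : @stable_freq R d b J th <= 1 - r N / 2.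
    apply: stable_freq_le => //.
    have := @cos_dyadic_angle R s; rewrite -/th.
    rewrite -[X in X <= _]mul1r ler_pdivrMr ?mulr_gt0 ?exprn_gt0// => H.
    rewrite -[leLHS]mulr1 /N -mulnA mulnCA natrM -mulrA ler_wpM2l//.
    by rewrite natrM natrX mulrC.
  have r01 : 0 <= r N / 2 <= 1.
    have := sibuya_tail_le1 b0 b1 N; have := sibuya_tail_gt0 b1 N; lra.
  have := bernoulli_contraction k r01.
  have : @stable_freq R d b J th ^+ k <= (1 - r N / 2) ^+ k.
    by rewrite lerXn2r// ?nnegrE ?stable_freq_ge0// subr_ge0; case/andP: r01.
  have : 0 <= @stable_freq R d b J th ^+ k.
    by rewrite exprn_ge0// stable_freq_ge0.
  move: (_ ^+ k) ((1 - _) ^+ k) => u v u0 uv; nra.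
have cosle : iter k (T J) (cosine th i) 0 <= 1 / 8.
  rewrite (pos_iter_eigen posT (a := @stable_freq R d b J th)).
    by rewrite /cosine mxE mulr0 cos0 mulr1.
  by move=> y; exact: stable_step_cosine.
have cosge : 1 / 2 * iter k (T J) (fun=> 1) 0 - 3 / 2 * iter k (T J) F 0 <=
    iter k (T J) (cosine th i) 0.
  have posTk := pos_iter posT k.
  rewrite -mulNr -(pos_const posTk) addrC -(pos_linear posTk).
  apply: (pos_monotone posTk) => y; rewrite /F /cosine.
  case: ltP => ys.
    by rewrite mulr1; have := cos_geN1 (th * (y 0 i)%:~R); lra.
  by rewrite mulr0 add0r; exact: cos_dyadic_angle_ge.
have := iter_stable_step1_ge J k 0.
by lra.
Qed.

End Spread.

(** * Steering by sign flips *)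

Section Steering.
Context {R : realType} {d : nat}.
Hypothesis d1 : (1 < d)%N.
Let d0 : (0 < d)%N := ltnW d1.
Local Notation V := 'rV[int]_d.
Implicit Types (f g : V -> R) (x y : V).
Variable b : R.
Hypotheses (b0 : 0 < b) (b1 : b < 1).
Local Notation r := (sibuya_tail b).
Local Notation T J := (@stable_step R d b J).

Definition in_tube N (l : 'I_d) x : bool :=
  [forall i, (i != l) ==> (((x 0 i)%:~R : R) ^+ 2 < N%:R)].

Definition tube_gain N l s x y : bool :=
  in_tube N l (x + y) && (2 ^+ s <= y 0 l).

(** Two numbers of opposite signs partially cancel: one of [u * (u + v)] and
[v * (u + v)] is nonpositive, since their product is. *)
Lemma sqr_add_opposite (u v w : R) : u * v <= 0 -> u ^+ 2 < w -> v ^+ 2 < w ->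
  (u + v) ^+ 2 < w.
Proof.
move=> uv uw vw; rewrite sqrrD.
have [H|H] : u ^+ 2 + u * v <= 0 \/ v ^+ 2 + u * v <= 0.
- rewrite !expr2 -mulrDr [u * v]mulrC -mulrDr [v + u]addrC.
  have uv2 : u * (u + v) * (v * (u + v)) <= 0.
    by rewrite mulrACA mulr_le0_ge0// -expr2 sqr_ge0.
  have [|u0] := leP (u * (u + v)) 0; first by left.
  by right; rewrite -(pmulr_rle0 _ u0).
- by rewrite mulr2n; lra.
- by rewrite mulr2n; lra.
Qed.

(** Flip the transverse coordinates in which the displacement has the same sign
as the position, and the vertical one if it points downwards. *)
Lemma tube_gain_flip N l s x y : in_tube N l x -> in_tube N l y ->
  2 ^+ s < `|y 0 l| -> exists S, tube_gain N l s x (flip S y).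
Proof.
move=> /forallP xN /forallP yN yl.
exists [set i | if i == l then y 0 l < 0 else 0 < x 0 i * y 0 i]%SET.
apply/andP; split.
  apply/forallP => i; apply/implyP => il.
  have /implyP/(_ il) xi := xN i; have /implyP/(_ il) yi := yN i.
  rewrite !mxE inE (negPf il) rmorphD/=; apply: sqr_add_opposite => //.
    by case: ltP => xy; rewrite -intrM lerz0 ?mulrN ?oppr_le0// ltW.
  by case: ifP; rewrite ?intrN ?sqrrN.
rewrite !mxE inE eqxx; case: ltP => yl0.
  by move: yl; rewrite ltr0_norm// => /ltW.
by move: yl; rewrite ger0_norm// => /ltW.
Qed.

(** The law of the walk is invariant under the [2 ^ d] sign flips, so that each
of them carries a proportion at least [2 ^- d] of a flip-invariant event. *)
Lemma iter_stable_step_tube_gain J k N l s x : in_tube N l x ->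
  iter k (T J) (fun y => (in_tube N l y && (2 ^+ s < `|y 0 l|)%R)%:R) 0 <=
  (2 ^ d)%:R * iter k (T J) (fun y => (tube_gain N l s x y)%:R) 0.
Proof.
move=> xN; set f := fun y => (tube_gain _ _ _ _ y)%:R.
have posTk := pos_iter (@stable_step_positive R d b b0 b1 J) k.
have -> : (2 ^ d)%:R * iter k (T J) f 0 =
    iter k (T J) (fun y => \sum_(S : {set 'I_d}) f (flip S y)) 0.
  rewrite (pos_sum posTk).
  under eq_bigr => S _.
    rewrite (equivariant_iter _ (stable_step_flip b S J)).
    rewrite (_ : flip S 0 = 0); last first.
      by apply/rowP => i; rewrite !mxE oppr0 if_same.
    over.
  rewrite sumr_const -[RHS]mulr_natl; congr (_%:R * _).
  by rewrite -cardsT -powersetT card_powerset cardsT card_ord.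
apply: (pos_monotone posTk) => y.
case: (boolP (_ && _)) => [/andP[yN yl]|_]; last first.
  by apply: sumr_ge0 => S _; exact: ler0n.
have [S gS] := tube_gain_flip xN yN yl.
by rewrite (bigD1 S)//= {1}/f gS lerDl; apply: sumr_ge0 => S2 _; exact: ler0n.
Qed.

(** The constant [sg] is chosen first, from [b] and [d] only, so that the
probability to leave a tube whose squared width is [2 ^ sg] times the natural
one is small compared with that of a vertical displacement; the number [k] of
steps is then tuned to [14 <= k * r N <= 15]. *)
Lemma stable_steer (l : 'I_d) : exists sg, forall s, exists k J0,
  forall J x, (J0 <= J)%N -> in_tube (2 ^ sg * (2 * d * 4 ^ s)) l x ->
  (16 * 2 ^ d)%:R^-1 <= iter k (T J)
    (fun y => (tube_gain (2 ^ sg * (2 * d * 4 ^ s)) l s x y)%:R) 0.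
Proof.
have c0 : 0 < 1 - b by rewrite subr_gt0.
have cb0 : 0 < (1 - b) * (b / 2) by rewrite mulr_gt0// divr_gt0.
pose sg := Num.bound (240 * d%:R / ((1 - b) * (b / 2))).
have sgP : 240 * d%:R <= (1 + sg%:R * (b / 2)) * (1 - b).
  have : 240 * d%:R / ((1 - b) * (b / 2)) < sg%:R.
    by apply: archi_boundP; rewrite divr_ge0// ltW.
  rewrite ltr_pdivrMr// => H.
  have -> : (1 + sg%:R * (b / 2)) * (1 - b) =
    sg%:R * ((1 - b) * (b / 2)) + (1 - b) by ring.
  lra.
exists sg => s; set N := (2 * d * 4 ^ s)%N; set N' := (2 ^ sg * N)%N.
have N0 : (0 < N)%N by rewrite !muln_gt0 d0 expn_gt0.
have N'0 : (0 < N')%N by rewrite muln_gt0 expn_gt0.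
have rN0 := sibuya_tail_gt0 b1 N.
pose k := (Num.truncn (14 / r N)).+1.
have /andP[k14 k15] : 14 <= k%:R * r N <= 15.
  have /andP[t1 t2] : (Num.truncn (14 / r N))%:R <= 14 / r N < k%:R.
    by apply: truncn_itv; rewrite divr_ge0// ltW.
  rewrite -ler_pdivrMr// (ltW t2)/= /k -natr1 mulrDl mul1r.
  rewrite (_ : 15 = 14 + 1 :> R); last by ring.
  by rewrite lerD ?sibuya_tail_le1// -ler_pdivlMr.
have k4 : 0 < 1 / 4 / k%:R :> R by rewrite !divr_gt0.
have [J1 J1P] := sibuya_tail_small b0 b1 k4.
exists k, (maxn J1 N) => J x; rewrite geq_max => /andP[J1J NJ] xN.
rewrite natrM invfM -(ler_pM2l (x := (2 ^ d)%:R)) ?ltr0n ?expn_gt0//.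
rewrite mulrCA mulfV ?mulr1 ?pnatr_eq0 -?lt0n ?expn_gt0//.
apply: le_trans (iter_stable_step_tube_gain _ _ _ xN).
have posTk := pos_iter (@stable_step_positive R d b b0 b1 J) k.
pose A y : R := (2 ^+ s < `|y 0 l|)%R%:R.
pose E i y : R := (N'%:R <= ((y 0 i)%:~R : R) ^+ 2)%R%:R.
apply: (@le_trans _ _
  (iter k (T J) (fun y => -1 * (\sum_(i < d) E i y) + A y) 0)); last first.
  apply: (pos_monotone posTk) => y; rewrite mulN1r.
  have S0 : 0 <= \sum_(i < d) E i y by apply: sumr_ge0 => i _; exact: ler0n.
  case: (boolP (in_tube N' l y)) => [yN|/forallPn[i]].
    by rewrite addrC gerBl.
  rewrite negb_imply -leNgt => /andP[_ iN].
  rewrite addrC subr_le0.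
  apply: (@le_trans _ _ 1); first by rewrite /A; case: ltP.
  by rewrite (bigD1 i)//= {1}/E iN lerDl sumr_ge0.
rewrite (pos_linear posTk) (pos_sum posTk) mulN1r.
have spread := stable_spread_ge d1 b0 b1 l NJ k14.
have exits : \sum_(i < d) iter k (T J) (E i) 0 <= 1 / 16.
  apply: (@le_trans _ _ (\sum_(i < d) (k%:R * (r N' / (1 - b))))).
    by apply: ler_sum => i _; exact: stable_exit_le.
  rewrite sumr_const card_ord.
  have := sibuya_tail_decay b0 b1 sg N0; rewrite -/N'.
  set q := 1 + _ in sgP *.
  have rN'0 := sibuya_tail_gt0 b1 N'.
  move=> dec.
  have c1 : 0 < q * (1 - b) by apply: lt_le_trans sgP; rewrite mulr_gt0// ltr0n.
  have q0 : 0 < q by move: c1; rewrite pmulr_lgt0.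
  (* The expected number of exits is at most [15 * d / (q * (1 - b))]. *)
  have kq : k%:R * r N' <= 15 / q.
    by rewrite ler_pdivlMr// (le_trans _ k15)// -mulrA ler_wpM2l.
  apply: (@le_trans _ _ (15 * d%:R / (q * (1 - b)))).
    have -> : 15 * d%:R / (q * (1 - b)) = 15 / q / (1 - b) * d%:R.
      by field; rewrite !gt_eqF.
    by rewrite -[leLHS]mulr_natr mulrA !ler_wpM2r// invr_ge0 ltW.
  by rewrite ler_pdivrMr//; lra.
have kJ : k%:R * r J <= 1 / 4.
  have := J1P J J1J; rewrite ler_pdivlMr ?ltr0n// mulrC //.
lra.
Qed.

End Steering.

(** * Climbing a tube *)

Section Climb.
Context {R : realType} {d : nat}.
Hypothesis d1 : (1 < d)%N.
Let d0 : (0 < d)%N := ltnW d1.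
Local Notation V := 'rV[int]_d.
Implicit Types (f g : V -> R) (x y : V).
Variable b : R.
Hypotheses (b0 : 0 < b) (b1 : b < 1).
Local Notation r := (sibuya_tail b).
Local Notation T J := (@stable_step R d b J).
Local Notation in_tube := (@in_tube R d).
Local Notation tube_gain := (@tube_gain R d).

Lemma dyadic_scale (C : nat) (z : R) : (0 < C)%N -> C%:R <= z ->
  exists s, (C * 4 ^ s)%:R <= z < (C * 4 ^ s.+1)%:R.
Proof.
move=> C0 Cz; pose P s := z < (C * 4 ^ s.+1)%:R.
have exP : exists s, P s.
  exists (Num.bound z); apply: lt_le_trans (archi_boundP _) _.
    exact: le_trans Cz.
  rewrite ler_nat (leq_trans _ (leq_pmull _ C0))// ltnW//.
  by rewrite (leq_trans (ltn_expl _ (isT : (1 < 4)%N)))// leq_exp2l.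
case: (ex_minnP exP) => s sP smin; exists s; rewrite -[_ < _]/(P s) sP andbT.
case: s sP smin => [|s] sP smin; first by rewrite expn0 muln1.
by rewrite leNgt; apply/negP => /smin; rewrite ltnn.
Qed.

Variable u : V -> R.
Hypothesis u_le1 : forall x, u x <= 1.
Hypothesis u_sub : forall J x, u x <= T J u x + r J.

(** By induction on the number [q] of climbs: one block of [k] steps gains
[2 ^ s] in height inside the tube with probability at least [2 * p], and half of
that absorbs the mass lost by truncation. *)
Lemma climb (p : R) (l : 'I_d) N s k J0 n : 0 < p ->
  (forall J x, (J0 <= J)%N -> in_tube N l x ->
    2 * p <= iter k (T J) (fun y => (tube_gain N l s x y)%:R) 0) ->
  (forall x, in_tube N l x -> n%:Z <= x 0 l -> u x <= 0) ->
  forall q x, in_tube N l x -> n%:Z <= x 0 l + q%:Z * 2 ^+ s ->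
  u x <= 1 - p ^+ q.
Proof.
move=> p0 steer top; elim=> [|q IH] x xN xn.
  by rewrite expr0 subrr; apply: top => //; rewrite mul0r addr0 in xn.
have pq0 : 0 < p ^+ q by rewrite exprn_gt0.
have e0 : 0 < p ^+ q * p / k.+1%:R by rewrite divr_gt0// mulr_gt0.
have [J1 J1P] := sibuya_tail_small b0 b1 e0.
pose J := maxn J0 J1.
have posT := @stable_step_positive R d b b0 b1 J.
have posTk := pos_iter posT k.
have step : u x <= iter k (T J) u x + k%:R * r J.
  apply: pos_iter_subharmonic => // [y|]; first exact: stable_step_le1.
  exact/ltW/sibuya_tail_gt0.
have small : k%:R * r J <= p ^+ q * p.
  have := J1P J (leq_maxr _ _); rewrite ler_pdivlMr ?ltr0n// mulrC.
  apply: le_trans; rewrite ler_wpM2r ?ler_nat//.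
  exact/ltW/sibuya_tail_gt0.
have gain : iter k (T J) u x <= - p ^+ q * (2 * p) + 1.
  rewrite -[x in iter _ _ _ x]addr0.
  rewrite -(equivariant_iter k (stable_step_shift b x J)).
  apply: (@le_trans _ _ (iter k (T J)
      (fun y => - p ^+ q * (tube_gain N l s x y)%:R + 1) 0)).
    apply: (pos_monotone posTk) => y.
    case: (boolP (tube_gain _ _ _ _ _)) => [/andP[xyN ys]|_]; last first.
      by rewrite mulr0 add0r.
    rewrite mulr1 [leRHS]addrC; apply: IH => //.
    apply: (le_trans xn); rewrite mxE -addrA lerD2l -addn1 PoszD mulrDl mul1r.
    by rewrite [leLHS]addrC lerD2r.
  rewrite (pos_linear posTk) lerD//; last exact: iter_stable_step1_le.
  by rewrite ler_nM2l ?oppr_lt0//; apply: steer => //; exact: leq_maxl.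
apply: (le_trans step); rewrite exprSr.
lra.
Qed.

(** The number [2 * M] of climbs depends on [c], [b] and [d] only: the dyadic
scale is comparable with the radius of the target tube, hence with the height
[n], and taking [n] large swallows the position of the starting point. *)
Lemma avoidance_bound (c : R) (l : 'I_d) : 0 < c ->
  (forall n0, exists n, (n0 <= n)%N /\ forall x,
    (forall i, i != l -> ((x 0 i)%:~R : R) ^+ 2 <= c * n%:R ^+ 2) ->
    n%:Z <= x 0 l -> u x <= 0) ->
  exists p : R, 0 < p /\ forall x, u x <= 1 - p.
Proof.
move=> c0 top.
have [sg steer] := stable_steer d1 b0 b1 l.
pose C := (2 ^ sg * (2 * d))%N.
have C0 : (0 < C)%N by rewrite !muln_gt0 expn_gt0 d0.
pose M := (Num.bound (4 * C%:R / c)).+1.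
have MP : 4 * C%:R / c <= M%:R ^+ 2.
  apply: (@le_trans _ _ M%:R).
    rewrite (le_trans (ltW (archi_boundP _)))// ?ler_nat//.
    by rewrite divr_ge0// ltW.
  by rewrite expr2 ler_peMr// ler1n.
pose p : R := (2 * (16 * 2 ^ d)%:R)^-1.
have p0 : 0 < p by rewrite invr_gt0 mulr_gt0// ltr0n muln_gt0 expn_gt0.
exists (p ^+ (2 * M)); split=> [|x]; first by rewrite exprn_gt0.
(* A height [n] at which the tube has caught up with the starting point. *)
pose B0 := Num.bound (C%:R / c).
pose Bi (i : 'I_d) := Num.bound (4 * ((x 0 i)%:~R : R) ^+ 2 / c).
pose bnd := (B0 + \sum_i Bi i + absz (x ord0 l))%N.
have [n [nb topn]] := top bnd.+1.
have n1 : 1 <= n%:R :> R by rewrite ler1n (leq_trans _ nb).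
have nbig z : 0 <= z -> (Num.bound (z / c) <= bnd)%N -> z < c * n%:R ^+ 2.
  move=> z0 zb; rewrite mulrC -ltr_pdivrMr//.
  apply: (@lt_le_trans _ _ n%:R); last by rewrite expr2 ler_peMr.
  apply: (lt_le_trans (archi_boundP _)); first by rewrite divr_ge0// ltW.
  by rewrite ler_nat (leq_trans zb)// (leq_trans _ nb).
have [s /andP[s1 s2]] : exists s,
    (C * 4 ^ s)%:R <= c * n%:R ^+ 2 < (C * 4 ^ s.+1)%:R.
  apply: dyadic_scale => //; apply/ltW/nbig => //.
  by rewrite /bnd -addnA leq_addr.
have [k [J0 kJ0]] := steer s.
have NE : (2 ^ sg * (2 * d * 4 ^ s) = C * 4 ^ s)%N by rewrite /C !mulnA.
rewrite NE in kJ0.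
apply: (@climb p l (C * 4 ^ s) s k J0 n).
- exact: p0.
- move=> J y J0J yN; apply: le_trans (kJ0 J y J0J yN).
  by rewrite /p invfM mulrA mulfV ?mul1r// pnatr_eq0.
- move=> y /forallP yN; apply: topn => i il.
  have /implyP/(_ il) := yN i => /ltW/le_trans; exact.
- apply/forallP => i; apply/implyP => il.
  have xi : 4 * ((x 0 i)%:~R : R) ^+ 2 < c * n%:R ^+ 2.
    apply: nbig; first by rewrite mulr_ge0// sqr_ge0.
    by rewrite /bnd (bigD1 i)//= -!addnA addnCA leq_addr.
  move: (lt_trans xi s2); rewrite expnS mulnCA natrM.
  by rewrite ltr_pM2l.
- have xl : - n%:Z <= x 0 l.
    rewrite lerNl (le_trans (ler_norm _))// normrN -abszE lez_nat.
    by rewrite (leq_trans _ (ltnW nb))// leq_addl.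
  have nM : (n <= M * 2 ^ s)%N.
    rewrite -(ler_nat R) -ler_sqr ?nnegrE// natrM exprMn natrX.
    rewrite -exprM mulnC exprM.
    have s4 : (2 : R) ^+ 2 = 4 by ring.
    rewrite s4.
    apply: (@le_trans _ _ (4 * C%:R / c * 4 ^+ s)); last first.
      by rewrite ler_wpM2r// exprn_ge0.
    rewrite mulrAC ler_pdivlMr// mulrC (le_trans (ltW s2))//.
    by rewrite natrM natrX exprS mulrCA mulrA.
  have {}nM : n%:Z <= M%:Z * 2 ^+ s.
    have -> : M%:Z * 2 ^+ s = (M * 2 ^ s)%N%:Z.
      by rewrite PoszM -(natz (2 ^ s)%N) natrX.
    by rewrite lez_nat.
  by rewrite PoszM -mulrA; lra.
Qed.

End Climb.

(** * Avoidance probabilities *)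

Section Avoidance.
Context {R : realType} {d : nat}.
Hypothesis d1 : (1 < d)%N.
Let d0 : (0 < d)%N := ltnW d1.
Local Notation V := 'rV[int]_d.
Implicit Types (f g : V -> R) (x y : V).
Variable b : R.
Hypotheses (b0 : 0 < b) (b1 : b < 1).
Local Notation r := (sibuya_tail b).
Local Notation T J := (@stable_step R d b J).

(** The truncations increase with [J] on nonnegative functions, so that the
limit is the genuine transition operator of the stable walk. *)
Definition stable_operator f x : R := limn (fun J => T J f x).

Let itv01 f := forall x, 0 <= f x <= 1.

Lemma stable_step_nondecreasing f x : (forall y, 0 <= f y) ->
  nondecreasing_seq (fun J => T J f x).
Proof.
move=> f0; apply/nondecreasing_seqP => J.
rewrite /stable_step big_ord_recr/= lerDl mulr_ge0 ?sibuya_mass_ge0//.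
exact: (pos_ge0 (pos_iter (@srw_step_positive R d) J.+1)).
Qed.

Lemma stable_step_le f M J x : (forall y, f y <= M) -> 0 <= M -> T J f x <= M.
Proof.
move=> fM M0; have posT := @stable_step_positive R d b b0 b1 J.
apply: (@le_trans _ _ (T J (fun=> M) x)); first exact: (pos_monotone posT).
by rewrite (pos_const posT) -[leRHS]mulr1 ler_wpM2l// stable_step_le1.
Qed.

Lemma stable_step_cvg f x : itv01 f ->
  T J f x @[J --> \oo] --> stable_operator f x.
Proof.
move=> f01; apply: nondecreasing_is_cvgn.
  by apply: stable_step_nondecreasing => y; case/andP: (f01 y).
exists 1 => _ [J _ <-]; apply: stable_step_le => // y.
by case/andP: (f01 y).
Qed.

Lemma stable_step_le_operator f J x : itv01 f -> T J f x <= stable_operator f x.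
Proof.
move=> f01; apply: (nondecreasing_cvgn_le (u_ := fun J => T J f x)).
  by apply: stable_step_nondecreasing => y; case/andP: (f01 y).
by apply/cvg_ex; exists (stable_operator f x); exact: stable_step_cvg.
Qed.

Lemma stable_operator_le f J x : itv01 f ->
  stable_operator f x <= T J f x + r J.
Proof.
move=> f01; apply: limr_le.
  by apply/cvg_ex; exists (stable_operator f x); exact: stable_step_cvg.
exists J => // K /= JK.
have nd : nondecreasing_seq (fun J => T J (fun y => 1 - f y) x).
  apply: stable_step_nondecreasing => y; rewrite subr_ge0.
  by case/andP: (f01 y).
have := nd _ _ JK.
have sub1 L : T L (fun y => 1 - f y) x = 1 - r L - T L f x.
  have posT := @stable_step_positive R d b b0 b1 L.
  rewrite -(@stable_step1 R d d1 b L x) -mulN1r addrC -(pos_linear posT).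
  by congr (T L _ x); apply/funext => y; rewrite mulN1r addrC.
rewrite !sub1; have := sibuya_tail_gt0 b1 K.
by lra.
Qed.

Lemma stable_operator_itv f : itv01 f -> itv01 (stable_operator f).
Proof.
move=> f01 x; apply/andP; split.
  apply: le_trans (stable_step_le_operator 0 x f01).
  apply: (pos_ge0 (@stable_step_positive R d b b0 b1 0)) => y.
  by case/andP: (f01 y).
apply: limr_le.
  by apply/cvg_ex; exists (stable_operator f x); exact: stable_step_cvg.
by near=> J; apply: stable_step_le => // y; case/andP: (f01 y).
Unshelve. all: by end_near.
Qed.

Variable B : set V.

(** The probability that the stable walk from [x] is outside [B] at the times
[0, ..., N]. *)
Fixpoint avoid N x : R :=
  if `[< B x >] then 0
  else if N is N'.+1 then stable_operator (avoid N') x else 1.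

Lemma avoid_itv N : itv01 (avoid N).
Proof.
elim: N => [|N IH] x /=; case: ifP; rewrite ?lexx ?ler01// => _.
exact: stable_operator_itv.
Qed.

Lemma avoid_nonincreasing x : nonincreasing_seq (fun N => avoid N x).
Proof.
apply/nonincreasing_seqP => N; elim: N x => [|N IH] x /=.
  by case: ifP => // _; have /andP[] := stable_operator_itv (avoid_itv 0) x.
case: ifP => // _; apply: ler_lim.
- apply/cvg_ex; exists (stable_operator (avoid N.+1) x).
  exact: stable_step_cvg (avoid_itv _).
- apply/cvg_ex; exists (stable_operator (avoid N) x).
  exact: stable_step_cvg (avoid_itv _).
- by near=> J; apply: (pos_monotone (@stable_step_positive R d b b0 b1 J)).
Unshelve. all: by end_near.
Qed.

Definition avoid_forever x : R := limn (fun N => avoid N x).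

Lemma avoid_cvg x : avoid N x @[N --> \oo] --> avoid_forever x.
Proof.
apply: nonincreasing_is_cvgn; first exact: avoid_nonincreasing.
by exists 0 => _ [N _ <-]; have /andP[] := avoid_itv N x.
Qed.

Let is_cvg_avoid x : cvgn (fun N => avoid N x).
Proof. by apply/cvg_ex; exists (avoid_forever x); exact: avoid_cvg. Qed.

Lemma avoid_forever_itv : itv01 avoid_forever.
Proof.
move=> x; apply/andP; split.
  by apply: limr_ge => //; near=> N; have /andP[] := avoid_itv N x.
by apply: limr_le => //; near=> N; have /andP[] := avoid_itv N x.
Unshelve. all: by end_near.
Qed.

Lemma avoid_forever_in x : B x -> avoid_forever x = 0.
Proof.
move=> Bx; apply/cvg_lim => //; apply: cvg_near_cst; near=> N.
have avoid0 M : avoid M x = 0 by case: M => [|M] /=; rewrite asboolT.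
exact: avoid0.
Unshelve. all: by end_near.
Qed.

Lemma iter_srw_step_cvg (F : nat -> V -> R) (f : V -> R) k x :
  (forall y, F N y @[N --> \oo] --> f y) ->
  iter k srw_step (F N) x @[N --> \oo] --> iter k srw_step f x.
Proof.
move=> Ff; elim: k x => [|k IH] x /=; first exact: Ff.
apply: cvgM; last exact: cvg_cst.
apply: cvg_big => [|i _]; first exact: add_continuous.
by apply: cvgD; exact: IH.
Qed.

Lemma stable_step_cvg_fun (F : nat -> V -> R) (f : V -> R) J x :
  (forall y, F N y @[N --> \oo] --> f y) ->
  T J (F N) x @[N --> \oo] --> T J f x.
Proof.
move=> Ff; rewrite /stable_step.
apply: cvg_big => [|j _]; first exact: add_continuous.
by apply: cvgM; [exact: cvg_cst|exact: iter_srw_step_cvg].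
Qed.

Lemma avoid_forever_sub J x : avoid_forever x <= T J avoid_forever x + r J.
Proof.
have [Bx|nBx] := pselect (B x).
  rewrite avoid_forever_in// addr_ge0 ?(ltW (sibuya_tail_gt0 _ _))//.
  apply: (pos_ge0 (@stable_step_positive R d b b0 b1 J)) => y.
  by case/andP: (avoid_forever_itv y).
apply: (@ler_cvg_to _ eventually _ _ (fun N => avoid N.+1 x)
    (fun N => T J (avoid N) x + r J)).
- by have := @avoid_cvg x; rewrite -(cvg_shiftS (fun N => avoid N x)).
- by apply: cvgD; [exact: stable_step_cvg_fun avoid_cvg|exact: cvg_cst].
- near=> N; rewrite /= asboolF//; exact: stable_operator_le (avoid_itv N).
Unshelve. all: by end_near.
Qed.

(** Conditioning on the position at time [N]: the walk must survive up to [N],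
and then avoid [B] forever from where it stands. *)
Lemma avoid_forever_le q N x : 0 <= q -> (forall y, avoid_forever y <= q) ->
  avoid_forever x <= q * avoid N x.
Proof.
move=> q0 uq; elim: N x => [|N IH] x.
  have [Bx|nBx] := pselect (B x).
    by rewrite avoid_forever_in//= asboolT// mulr0.
  by rewrite /= asboolF// mulr1.
have [Bx|nBx] := pselect (B x).
  by rewrite avoid_forever_in//= asboolT// mulr0.
rewrite /= asboolF//; apply/ler_addgt0Pr => e e0.
have [J /(_ _ (leqnn J)) rJ] := sibuya_tail_small b0 b1 e0.
apply: (le_trans (avoid_forever_sub J x)); apply: lerD => //.
have posT := @stable_step_positive R d b b0 b1 J.
apply: (@le_trans _ _ (T J (fun y => q * avoid N y) x)).
  exact: (pos_monotone posT).
rewrite (pos_scale posT) ler_wpM2l//.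
exact: stable_step_le_operator (avoid_itv N).
Qed.

Lemma avoid_cvg0 (p : R) x : 0 < p -> (forall y, avoid_forever y <= 1 - p) ->
  avoid N x @[N --> \oo] --> 0.
Proof.
move=> p0 up; suff <- : avoid_forever x = 0 by exact: avoid_cvg.
have q0 : 0 <= 1 - p.
  by apply: le_trans (up x); case/andP: (avoid_forever_itv x).
have : avoid_forever x <= (1 - p) * avoid_forever x.
  apply: (@ler_cvg_to _ eventually _ _ (fun=> avoid_forever x)
    (fun N => (1 - p) * avoid N x)).
  - exact: cvg_cst.
  - by apply: cvgM; [exact: cvg_cst|exact: avoid_cvg].
  - by near=> N; exact: avoid_forever_le.
have /andP[u0 _] := avoid_forever_itv x.
nra.
Unshelve. all: by end_near.
Qed.

Lemma avoid_tube_cvg0 (c : R) (l : 'I_d) : 0 < c ->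
  (forall n0, exists n, (n0 <= n)%N /\ forall x,
    (forall i, i != l -> ((x 0 i)%:~R : R) ^+ 2 <= c * n%:R ^+ 2) ->
    n%:Z <= x 0 l -> B x) ->
  forall x, avoid N x @[N --> \oo] --> 0.
Proof.
move=> c0 top x.
have [p [p0 up]] : exists p : R, 0 < p /\ forall x, avoid_forever x <= 1 - p.
  apply: (@avoidance_bound R d d1 b b0 b1 avoid_forever _
    avoid_forever_sub c l c0) => [y|n0].
    by case/andP: (avoid_forever_itv y).
  have [n [nn topn]] := top n0; exists n; split=> // y yn yl.
  by rewrite (avoid_forever_in (topn y yn yl)).
exact: avoid_cvg0 p0 up.
Qed.

End Avoidance.

(** * Convolution powers as iterated averages *)

Section SrwLaw.
Context {R : realType} {d : nat}.
Hypothesis d0 : (0 < d)%N.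
Local Notation V := 'rV[int]_d.
Implicit Types (f g : V -> R) (x y z : V).
Local Notation e i := (delta_mx 0 i : V).

Let steps : seq V :=
  [seq e i | i <- index_enum 'I_d] ++ [seq - e i | i <- index_enum 'I_d].

Let steps_uniq : uniq steps.
Proof.
have inje : injective (fun i : 'I_d => e i).
  move=> i j /rowP/(_ i); rewrite !mxE !eqxx/=.
  by case: eqP => // ij /eqP.
rewrite cat_uniq; apply/and3P; split.
- by rewrite map_inj_uniq ?index_enum_uniq.
- apply/hasPn => _ /mapP[i _ ->]; apply/mapP => -[j _].
  by move=> /rowP/(_ j); rewrite !mxE !eqxx/=; case: eqP.
- by rewrite map_inj_uniq ?index_enum_uniq// => i j /oppr_inj/inje.
Qed.

Lemma convolution_srw_law g z : convolution (@srw_law R d) g z = srw_step g z.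
Proof.
rewrite /convolution -(fsbig_widen [set` steps])//=; last first.
  move=> y [_ /= ys]; rewrite /srw_law indicE memNset ?mul0r//.
  move=> [i yi]; apply: ys; rewrite mem_cat.
  by apply/orP; case: yi => ->; [left|right]; apply/mapP; exists i;
    rewrite ?mem_index_enum.
rewrite -fsbig_seq// big_cat/= !big_map /srw_step -big_split/= mulr_suml.
apply: eq_bigr => i _; rewrite /srw_law !indicE !mem_set.
- by rewrite opprK (_ : true%:R = 1)//; ring.
- by exists i; right.
- by exists i; left.
Qed.

Lemma convolution_power_srw_law n :
  convolution_power (@srw_law R d) n = iter n srw_step (\1_[set 0]).
Proof.
elim: n => [//|n IH]; rewrite /convolution_power/= -/(convolution_power _ _) IH.
by apply/funext => z; rewrite convolution_srw_law.
Qed.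

Lemma srw_step_ge0 f x : (forall y, 0 <= f y) -> 0 <= srw_step f x.
Proof. exact: (pos_ge0 (@srw_step_positive R d)). Qed.

Lemma iter_srw_step_ge0 n f x : (forall y, 0 <= f y) ->
  0 <= iter n srw_step f x.
Proof. exact: (pos_ge0 (pos_iter (@srw_step_positive R d) n)). Qed.

Lemma esum_shift (a : V -> \bar R) v :
  \esum_(y in setT) a (y + v) = \esum_(y in setT) a y.
Proof.
apply/esym/reindex_esum; split=> //.
- by move=> y z _ _ /addIr.
- by move=> y _; exists (y - v); rewrite ?subrK.
Qed.

(** The steps of the simple walk are symmetric, so the averaging operator is
self-adjoint for the counting measure. *)
Lemma srw_step_adjoint g f x : (forall y, 0 <= g y) -> (forall y, 0 <= f y) ->
  \esum_(y in setT) (srw_step g y * f (x + y))%:E =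
  \esum_(y in setT) (g y * srw_step f (x + y))%:E.
Proof.
move=> g0 f0.
have D0 : 0 <= (2 * d)%:R^-1 :> R by rewrite invr_ge0.
pose D : R := (2 * d)%:R^-1.
transitivity (\esum_(y in setT) \sum_(i < d)
    ((g (y + e i) * f (x + y) * D)%:E + (g (y - e i) * f (x + y) * D)%:E)).
  apply: eq_esum => y _; rewrite sumEFin; congr EFin.
  rewrite /srw_step mulrAC !mulr_suml; apply: eq_bigr => i _.
  by rewrite -/D; ring.
transitivity (\esum_(y in setT) \sum_(i < d)
    ((g y * f (x + y - e i) * D)%:E +
     (g y * f (x + y + e i) * D)%:E)); last first.
  apply: eq_esum => y _; rewrite sumEFin; congr EFin.
  rewrite /srw_step mulrA mulr_sumr mulr_suml; apply: eq_bigr => i _.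
  by rewrite -/D; ring.
have pos (a c : R) : 0 <= a -> 0 <= c -> (0 <= (a * c * D)%:E)%E.
  by move=> a0 c0; rewrite lee_fin !mulr_ge0.
rewrite !esum_sum; try by move=> y i _ _; rewrite adde_ge0 ?pos.
apply: eq_bigr => i _; rewrite !esumD; try by move=> y _; rewrite pos.
congr (_ + _)%E.
- rewrite -(esum_shift _ (e i)); apply: eq_esum => y _.
  by rewrite addrA addrK.
- rewrite -(esum_shift _ (- e i)); apply: eq_esum => y _.
  by rewrite addrA subrK.
Qed.

Lemma esum_iter_srw_step n f x : (forall y, 0 <= f y) ->
  \esum_(y in setT) (iter n srw_step \1_[set 0] y * f (x + y))%:E =
  (iter n srw_step f x)%:E.
Proof.
elim: n f => [|n IH] f f0 /=.
  rewrite (esumID [set 0]); last first.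
    by move=> y _; rewrite lee_fin mulr_ge0.
  rewrite setTI esum_set1 ?lee_fin ?mulr_ge0// esum1 ?adde0.
    by rewrite indicE mem_set//= mul1r addr0.
  by move=> y [_ /= y0]; rewrite indicE memNset ?mul0r.
rewrite srw_step_adjoint//; last by move=> y; apply: iter_srw_step_ge0.
rewrite IH; last by move=> y; exact: srw_step_ge0.
by rewrite -iterSr.
Qed.

(** Averaging over a mixture of convolution powers is mixing the iterated
averages: by symmetry, the walk is run on the test function instead of on the
point mass. *)
Lemma esum_mixture (c : nat -> R) f x : (forall j, 0 <= c j) ->
  (forall y, 0 <= f y) ->
  \esum_(y in setT)
    ((\sum_(0 <= j <oo) (c j * iter j.+1 srw_step \1_[set 0] y)%:E) *
     (f (x + y))%:E)%E =
  (\sum_(0 <= j <oo) (c j * iter j.+1 srw_step f x)%:E)%E.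
Proof.
move=> c0 f0.
have i0 j y : 0 <= iter j.+1 srw_step \1_[set 0] y :> R.
  by apply: iter_srw_step_ge0.
pose a j y := (iter j.+1 srw_step \1_[set 0] y * (c j * f (x + y)))%:E.
have a0 j y : (0 <= a j y)%E.
  by rewrite lee_fin; apply: mulr_ge0; [exact: i0|exact: mulr_ge0].
transitivity (\esum_(y in setT) \esum_(j in setT) a j y).
  apply: eq_esum => y _; rewrite muleC -nneseriesZl//; last first.
    by move=> j _; rewrite lee_fin mulr_ge0.
  rewrite -nneseries_esumT//; apply: eq_eseriesr => j _.
  by rewrite /a -EFinM; congr EFin; ring.
transitivity (\esum_(j in setT) \esum_(y in setT) a j y).
  rewrite !esum_esum//.
  apply: (reindex_esum _ _ (fun k : nat * V => (k.2, k.1))); split=> //.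
  - by move=> [j1 y1] [j2 y2] _ _ /= [-> ->].
  - by move=> [y j] _; exists (j, y).
rewrite nneseries_esumT; last first.
  by move=> j; rewrite lee_fin mulr_ge0// iter_srw_step_ge0.
apply: eq_esum => j _; rewrite /a.
rewrite (esum_iter_srw_step _ _ (f := fun y => c j * f y)); last first.
  by move=> y; rewrite mulr_ge0.
by rewrite (pos_scale (pos_iter (@srw_step_positive R d) j.+1)).
Qed.

End SrwLaw.

(** * The Markov property *)

Section CountableValued.
Context {R : realType} {disp : measure_display} {Omega : measurableType disp}.
Context {P : probability Omega R} {V : countType}.

Definition preimages_measurable (X : Omega -> V) :=
  forall A : set V, measurable (X @^-1` A).

(** A [V]-valued variable splits any event along its values; the countable sum
is transported from [nat] along [pickle]. *)
Lemma countable_partition (X : Omega -> V) (E : set Omega) :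
  preimages_measurable X -> measurable E ->
  P E = \esum_(y in setT) P (E `&` X @^-1` [set y]).
Proof.
move=> mX mE.
pose F k := E `&` X @^-1` [set y | pickle y = k].
have mF k : measurable (F k) by apply: measurableI.
have PF : P E = (\sum_(0 <= k <oo) P (F k))%E.
  rewrite -measure_semi_bigcup//.
  - congr (P _); apply/seteqP; split=> [w Ew|w [k _ []]//].
    by exists (pickle (X w)).
  - apply/trivIsetP => i j _ _ /eqP ij; apply/seteqP; split=> // w.
    by move=> [[_ /= wi] [_ /= wj]]; apply: ij; rewrite -wi -wj.
  - exact: bigcup_measurable.
rewrite PF nneseries_esumT//.
transitivity (\esum_(k in range (@pickle V)) P (F k)).
  rewrite [RHS]esum_mkcond; apply: eq_esum => k _.
  case: ifPn => // /negP nk.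
  rewrite (_ : F k = set0) ?measure0//; apply/seteqP; split=> // w [_ /= wk].
  by apply: nk; rewrite inE; exists (X w).
rewrite esum_image; last by move=> x y _ _ /(pcan_inj (@pickleK V)).
apply: eq_esum => y _; congr (P _); apply/seteqP; split=> w [Ew /=].
  by move=> /(pcan_inj (@pickleK V)).
by move=> wy; split=> //=; rewrite wy.
Qed.

Lemma esum_scale_le (p : R) (a : V -> \bar R) :
  0 <= p -> (forall y, (0 <= a y)%E) ->
  (\esum_(y in setT) (p%:E * a y) <= p%:E * \esum_(y in setT) a y)%E.
Proof.
move=> p0 a0; apply: ge_ereal_sup => _ [Y [finY _] <-].
rewrite fsbig_finite//= -ge0_sume_distrr//.
rewrite lee_wpmul2l ?lee_fin// esum_ge//; exists Y => //.
by rewrite fsbig_finite.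
Qed.

End CountableValued.

Section Hitting.
Context {R : realType} {disp : measure_display} {Omega : measurableType disp}.
Context {P : probability Omega R} {d : nat}.
Local Notation V := 'rV[int]_d.
Variables (law : V -> \bar R) (xi : nat -> Omega -> V).
Hypothesis hxi : iid_with_law P law xi.
Implicit Types (x y : V) (s N : nat).

Let law_ge0 y : (0 <= law y)%E.
Proof. by rewrite -(iid_law hxi 0). Qed.

Lemma partial_sum_measurable s x n :
  preimages_measurable (fun w => x + \sum_(k < n) xi (s + k) w).
Proof.
elim: n => [|n IH] A.
  rewrite (_ : _ @^-1` A = if `[< A x >] then setT else set0).
    by case: ifP.
  apply/seteqP; split=> w /=; rewrite big_ord0 addr0.
    by move=> Ax; rewrite asboolT.
  by case: asboolP.
rewrite (_ : _ @^-1` A = \bigcup_(y : V) (xi (s + n) @^-1` [set y] `&`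
    (fun w => x + \sum_(k < n) xi (s + k) w) @^-1` [set v | A (v + y)])).
  apply: countable_bigcupT_measurable => [|y]; first exact: countableP.
  by apply: measurableI; [exact: (iid_measurable hxi)|exact: IH].
apply/seteqP; split=> w /=; rewrite big_ord_recr/= addrA.
  by move=> Aw; exists (xi (s + n) w).
by case=> y _ [/= ->].
Qed.

Definition cylinder s (z : nat -> V) : set Omega :=
  \bigcap_(k in [set` iota 0 s]) (xi k @^-1` [set z k]).

Lemma cylinder_measurable s z : measurable (cylinder s z).
Proof.
apply: bigcap_measurableType => k _; exact: (iid_measurable hxi).
Qed.

Lemma cylinderE s z : P (cylinder s z) = (\prod_(k <- iota 0 s) law (z k))%E.
Proof.
rewrite /cylinder (iid_independent hxi (fun k => [set z k]) (iota_uniq 0 s)).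
by apply: eq_bigr => k _; rewrite (iid_law hxi).
Qed.

Definition set_at s (z : nat -> V) y k := if k == s then y else z k.

Lemma cylinderS s z y :
  cylinder s.+1 (set_at s z y) = cylinder s z `&` xi s @^-1` [set y].
Proof.
apply/seteqP; split=> w.
  move=> H; split=> [k ks|].
    move: ks; rewrite [X in X -> _]/= mem_iota add0n => /andP[_ ks].
    have ks1 : k \in iota 0 s.+1 by rewrite mem_iota add0n; exact: leqW.
    by have := H k ks1; rewrite /= /set_at ltn_eqF.
  have ss1 : s \in iota 0 s.+1 by rewrite mem_iota add0n ltnSn.
  by have := H s ss1; rewrite /= /set_at eqxx.
move=> [H wy] k; rewrite [X in X -> _]/(is_true (k \in iota 0 s.+1)).
rewrite mem_iota add0n ltnS /= /set_at => ks.
case: eqP => [->//|/eqP nks]; apply: H => /=.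
by rewrite mem_iota add0n ltn_neqAle nks.
Qed.

Lemma measure_cylinderS s z y :
  (P (cylinder s z `&` xi s @^-1` [set y]) = P (cylinder s z) * law y)%E.
Proof.
rewrite -cylinderS !cylinderE -addn1 iotaD big_cat/= big_seq1 add0n.
rewrite /set_at eqxx; congr (_ * _)%E; apply: eq_big_seq => k.
by rewrite mem_iota add0n => /andP[_ ks]; rewrite ltn_eqF.
Qed.

Variable B : set V.

Definition avoiding N s x : set Omega :=
  [set w | forall n, (n <= N)%N -> ~ B (x + \sum_(k < n) xi (s + k) w)].

Lemma avoiding_measurable N s x : measurable (avoiding N s x).
Proof.
rewrite (_ : avoiding N s x = \bigcap_n
    ((fun w => x + \sum_(k < n) xi (s + k) w) @^-1`
       [set y | (n <= N)%N -> ~ B y])).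
  by apply: bigcapT_measurable => n; exact: partial_sum_measurable.
by apply/seteqP; split=> w H n; [move=> _; exact: H|exact: (H n I)].
Qed.

Lemma avoidingS N s x w :
  avoiding N.+1 s x w -> avoiding N s.+1 (x + xi s w) w.
Proof.
move=> H n nN; have := H n.+1 nN; rewrite big_ord_recl/= addn0 addrA.
by under eq_bigr => k _ do rewrite /bump/= add1n addnS -addSn.
Qed.

Variable b : R.
Hypotheses (d1 : (1 < d)%N) (b0 : 0 < b) (b1 : b < 1).
Hypothesis law_operator : forall f x, (forall y, 0 <= f y <= 1) ->
  \esum_(y in setT) (law y * (f (x + y))%:E)%E = (stable_operator b f x)%:E.

(** The Markov property, conditionally on the first [s] increments: splitting
along the value of the next increment extends the cylinder by one coordinate. *)
Lemma cylinder_avoiding_le N s z x :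
  (P (cylinder s z `&` avoiding N s x) <=
   P (cylinder s z) * (avoid b B N x)%:E)%E.
Proof.
have mC := cylinder_measurable.
have mA := avoiding_measurable.
elim: N s z x => [|N IH] s z x.
  have [Bx|nBx] := pselect (B x).
    rewrite /= asboolT// mule0 (_ : _ `&` _ = set0) ?measure0//.
    apply/seteqP; split=> // w [_ /(_ 0 (leqnn 0))].
    by rewrite big_ord0 addr0; exact.
  rewrite /= asboolF// mule1; apply: le_measure; rewrite ?inE//.
  exact: measurableI.
have [Bx|nBx] := pselect (B x).
  rewrite /= asboolT// mule0 (_ : _ `&` _ = set0) ?measure0//.
  apply/seteqP; split=> // w [_ /(_ 0 (leq0n _))].
  by rewrite big_ord0 addr0; exact.
have fC : P (cylinder s z) \is a fin_num by exact: fin_num_measure.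
rewrite /= asboolF// (countable_partition (X := xi s)); last 2 first.
- by move=> A; exact: (iid_measurable hxi).
- exact: measurableI.
rewrite -law_operator; last exact: (avoid_itv d1 b0 b1).
rewrite -(fineK fC).
apply: le_trans (esum_scale_le _ _); last 2 first.
- exact: fine_ge0.
- move=> y; rewrite mule_ge0// lee_fin.
  by have /andP[] := avoid_itv d1 b0 b1 B N (x + y).
apply: le_esum => y _; rewrite fineK// muleA -measure_cylinderS -cylinderS.
apply: le_trans (IH _ _ _); apply: le_measure; rewrite ?inE.
- by apply: measurableI; [exact: measurableI|exact: (iid_measurable hxi)].
- exact: measurableI.
rewrite cylinderS => w [[Cw Aw] /= <-]; split=> //.
exact: avoidingS.
Qed.

Lemma hitting_probability1 x : avoid b B N x @[N --> \oo] --> 0 ->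
  P [set w | exists n : nat, B (walk xi x n w)] = 1%E.
Proof.
move=> avoid0; set H := [set w | _].
have mH : measurable H.
  rewrite (_ : H = \bigcup_n
      ((fun w => x + \sum_(k < n) xi (0 + k) w) @^-1` B)); last first.
    by apply/seteqP; split=> w [n]; [exists n|exists n].
  by apply: bigcup_measurable => n _; exact: partial_sum_measurable.
suff H0 : P (~` H) = 0%E.
  by rewrite -[H]setCK probability_setC ?H0 ?sube0//; exact: measurableC.
apply/eqP; rewrite eq_le measure_ge0 andbT.
have le N : (P (~` H) <= (avoid b B N x)%:E)%E.
  have := cylinder_avoiding_le N 0 (fun=> 0) x.
  rewrite (_ : cylinder 0 _ = setT); last by apply/seteqP; split.
  rewrite probability_setT mul1e setTI; apply: le_trans.
  apply: le_measure; rewrite ?inE;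
    [exact: measurableC|exact: avoiding_measurable|].
  by move=> w /= nH n _ Bn; apply: nH; exists n.
have fH : P (~` H) \is a fin_num by apply: fin_num_measure; exact: measurableC.
rewrite -(fineK fH) lee_fin.
apply: (@ler_cvg_to _ eventually _ _ (fun=> fine (P (~` H)))
  (fun N => avoid b B N x)) => //.
  exact: cvg_cst.
by near=> N; rewrite -lee_fin fineK.
Unshelve. all: by end_near.
Qed.

End Hitting.

(** * The functional equation of the Gamma function *)

Section GammaFunction.
Context {R : realType}.
Local Notation mu := (@lebesgue_measure R).

Let gamma_integrand (s x : R) : R := x `^ s * expR (- x).

Lemma powR_continuous_at (s x : R) : 0 < x ->
  {for x, continuous (@powR R ^~ s)}.
Proof.
move=> x0; apply: differentiable_continuous; apply/derivable1_diffP.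
by apply: ex_derive; exact: is_derive1_powR.
Qed.

Let cvg_expRN (x : R) : (fun y => expR (- y)) @ x --> expR (- x).
Proof.
apply: continuous_comp; first exact: opp_continuous.
exact: continuous_expR.
Qed.

(** Integration by parts on a segment that avoids the singularity at 0. *)
Lemma gamma_integrand_segment (s a c : R) : 0 < a -> a < c ->
  (\int[mu]_(x in `[a, c]) (gamma_integrand s x)%:E +
    (gamma_integrand s c - gamma_integrand s a)%:E =
  s%:E * \int[mu]_(x in `[a, c]) (gamma_integrand (s - 1) x)%:E)%E.
Proof.
move=> a0 ac.
have pos x : x \in `[a, c]%classic -> 0 < x.
  by rewrite inE/= in_itv/= => /andP[ax _]; exact: lt_le_trans ax.
have poso x : x \in `]a, c[%R -> 0 < x.
  by rewrite in_itv/= => /andP[ax _]; exact: lt_trans ax.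
have ibp := @integration_by_parts R (@powR R ^~ s) (fun x => - expR (- x))
  (fun x => s * x `^ (s - 1)) (fun x => expR (- x)) a c ac.
have {ibp} -> : (\int[mu]_(x in `[a, c]) (gamma_integrand s x)%:E =
    (c `^ s * - expR (- c) - a `^ s * - expR (- a))%:E -
    \int[mu]_(x in `[a, c]) (s * x `^ (s - 1) * - expR (- x))%:E)%E.
  apply: ibp.
  - apply: continuous_in_subspaceT => x /pos x0.
    by apply: cvgM; [exact: cvg_cst|exact: powR_continuous_at].
  - split.
    + by move=> x /poso x0; apply: ex_derive; exact: is_derive1_powR.
    + exact/cvg_at_right_filter/powR_continuous_at.
    + by apply/cvg_at_left_filter/powR_continuous_at; exact: lt_trans ac.
  - by move=> x /poso x0; rewrite powR_derive1// in_itv/= x0.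
  - by apply: continuous_in_subspaceT => x _; exact: cvg_expRN.
  - split.
    + by move=> x _; exact: ex_derive.
    + by apply/cvg_at_right_filter; apply: cvgN; exact: cvg_expRN.
    + by apply/cvg_at_left_filter; apply: cvgN; exact: cvg_expRN.
  - move=> x _; rewrite derive1E.
    rewrite derive_val.
    by rewrite ?scaleN1r ?scalerN ?scaler1 ?mulrN1 ?mulrN ?mulr1 ?opprK.
have -> : (\int[mu]_(x in `[a, c]) (s * x `^ (s - 1) * - expR (- x))%:E =
    (- s)%:E * \int[mu]_(x in `[a, c]) (gamma_integrand (s - 1) x)%:E)%E.
  rewrite -integralZl//; last first.
    apply: continuous_compact_integrable; first exact: segment_compact.
    apply: continuous_in_subspaceT => x /pos x0; apply: cvgM.
      exact: powR_continuous_at.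
    exact: cvg_expRN.
  apply: eq_integral => x _.
  by rewrite /gamma_integrand -EFinM; congr EFin; ring.
rewrite EFinN mulNe oppeK addeAC -EFinD.
have -> : c `^ s * - expR (- c) - a `^ s * - expR (- a) +
    (gamma_integrand s c - gamma_integrand s a) = 0.
  by rewrite /gamma_integrand; ring.
by rewrite add0e.
Qed.

Let lo (n : nat) : R := n.+2%:R^-1.
Let hi (n : nat) : R := n.+2%:R.

Let lo_gt0 n : 0 < lo n.
Proof. by rewrite invr_gt0 ltr0n. Qed.

Let lo_lt_hi n : lo n < hi n.
Proof. by rewrite (@lt_trans _ _ 1) ?invf_lt1 ?ltr0n ?ltr1n. Qed.

Let gamma_integrand_lo s : 0 < s -> gamma_integrand s (lo n) @[n --> \oo] --> 0.
Proof.
move=> s0; apply: (@squeeze_cvgr _ _ _ _ (fun=> 0) (fun n => lo n `^ s)).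
- near=> n; rewrite mulr_ge0 ?powR_ge0 ?expR_ge0//=.
  by rewrite -[leRHS]mulr1 ler_wpM2l ?powR_ge0// -expR0 ler_expR oppr_le0 ltW.
- exact: cvg_cst.
- apply: (cvg_comp (G := 0^'+) lo (@powR R ^~ s)); last exact: powR_cvg0.
  move=> A [e /= e0 eA]; near=> n; apply: eA => //=.
  rewrite sub0r normrN gtr0_norm// /lo invf_plt ?posrE//.
  rewrite (@lt_trans _ _ n%:R) ?ltr_nat//; near: n; exact: nbhs_infty_gtr.
Unshelve. all: by end_near.
Qed.

Let gamma_integrand_hi s : 0 < s -> gamma_integrand s (hi n) @[n --> \oo] --> 0.
Proof.
move=> s0; pose k := Num.bound s.
apply: (@squeeze_cvgr _ _ _ _ (fun=> 0) (fun n => k.+1`!%:R * lo n)).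
- near=> n; rewrite mulr_ge0 ?powR_ge0 ?expR_ge0//=.
  have h1 : 1 <= hi n by rewrite /hi ler1n.
  have h0 : 0 < hi n by exact: lt_le_trans h1.
  have sk : hi n `^ s <= hi n ^+ k.
    rewrite -powR_mulrn ?(ltW h0)//; apply: (ler_powR h1).
    by apply/ltW/archi_boundP/ltW.
  have ek : hi n ^+ k.+1 / k.+1`!%:R <= expR (hi n).
    by apply: le_trans (expR_ge1Dxn k (ltW h0)); rewrite lerDr.
  rewrite /gamma_integrand expRN ler_pdivrMr ?expR_gt0// (le_trans sk)//.
  apply: (@le_trans _ _ (k.+1`!%:R * lo n * (hi n ^+ k.+1 / k.+1`!%:R))).
    have cancel (u v w : R) : u != 0 -> v != 0 -> u / v * (v * w / u) = w.
      by move=> u0 v0; field; rewrite u0 v0.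
    by rewrite exprS cancel ?gt_eqF// ltr0n fact_gt0.
  by rewrite ler_wpM2l// mulr_ge0// ltW.
- exact: cvg_cst.
- rewrite -[X in _ --> X](mulr0 (k.+1`!%:R)); apply: cvgM; first exact: cvg_cst.
  have := @cvg_harmonic R; rewrite -(cvg_shiftS (@harmonic R)).
  exact.
Unshelve. all: by end_near.
Qed.

(** The boundary terms vanish on the segments [[1 / (n + 2), n + 2]], which
exhaust the half-line; monotone convergence passes to the limit in the extended
reals, whether the integrals are finite or not. *)
Lemma Gamma_add1 (s : R) : 0 < s -> Gamma (s + 1) = s * Gamma s.
Proof.
move=> s0.
pose D n : set R := `[lo n, hi n]%classic.
pose I s : \bar R := (\int[mu]_(x in `]0%R, +oo[) (gamma_integrand s x)%:E)%E.
have mg r : measurable_fun [set: R] (gamma_integrand r).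
  apply: measurable_funM; first exact: measurable_powR.
  by apply: measurableT_comp.
have cvgI r :
    (\int[mu]_(x in D n) (gamma_integrand r x)%:E)%E @[n --> \oo] --> I r.
  rewrite /I (_ : `]0%R, +oo[%classic = \bigcup_n D n).
    apply: ge0_nondecreasing_set_cvg_integral => //.
    - apply/nondecreasing_seqP => n; apply/subsetPset => x; rewrite /D/=.
      rewrite !in_itv/= => /andP[l h]; rewrite (le_trans _ l) ?(le_trans h)//.
        by rewrite ler_nat.
      by rewrite lef_pV2 ?posrE ?ltr0n// ler_nat.
    - by move=> n; exact: measurable_itv.
    - by move=> n; apply/measurable_EFinP; exact: measurable_funTS (mg r).
    - by move=> n x _; rewrite lee_fin mulr_ge0 ?powR_ge0 ?expR_ge0.
  apply/seteqP; split=> x.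
    rewrite /= in_itv/= andbT => x0.
    exists (Num.bound x + Num.bound x^-1)%N => //; rewrite /D/= in_itv/=.
    apply/andP; split.
      rewrite /lo invf_ple ?posrE ?ltr0n//.
      rewrite ltW// (lt_le_trans (archi_boundP _)) ?invr_ge0 ?(ltW x0)//.
      by rewrite ler_nat -addn2 -addnA addnCA leq_addr.
    rewrite ltW// (lt_le_trans (archi_boundP _)) ?(ltW x0)//.
    by rewrite ler_nat -addn2 -addnA leq_addr.
  case=> n _; rewrite /D/= !in_itv/= andbT => /andP[l _].
  exact: lt_le_trans l.
have IE : I s = (s%:E * I (s - 1)%R)%E.
  have cvg1 : (\int[mu]_(x in D n) (gamma_integrand s x)%:E +
      (gamma_integrand s (hi n) - gamma_integrand s (lo n))%:E)%E
      @[n --> \oo] --> (I s + 0%:E)%E.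
    apply: cvgeD; first by rewrite fin_num_adde_defl.
      exact: cvgI.
    apply: cvg_EFin; first by near=> n.
    rewrite -[0](subr0 0); apply: cvgB; first exact: gamma_integrand_hi s0.
    exact: gamma_integrand_lo s0.
  have cvg2 : (s%:E * \int[mu]_(x in D n) (gamma_integrand (s - 1) x)%:E)%E
      @[n --> \oo] --> (s%:E * I (s - 1)%R)%E.
    by apply: cvgeZl => //; exact: cvgI.
  rewrite -[LHS]adde0; apply: (cvg_unique _ cvg1) => //.
  rewrite (_ : (fun n => _) =
    (fun n => s%:E * \int[mu]_(x in D n) (gamma_integrand (s - 1) x)%:E)%E)//.
  by apply/funext => n; rewrite gamma_integrand_segment.
rewrite /Gamma /Rintegral addrK -/(I s) -/(I (s - 1)).
have I0 : (0 <= I (s - 1)%R)%E.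
  by apply: integral_ge0 => x _; rewrite lee_fin mulr_ge0 ?powR_ge0 ?expR_ge0.
rewrite IE; move: I0; case: (I (s - 1)) => [v| |] //= _.
by rewrite gt0_muley ?lte_fin// mulr0.
Unshelve. all: by end_near.
Qed.

Lemma Gamma_ge0 (s : R) : 0 <= Gamma s.
Proof.
by apply: Rintegral_ge0 => x _; rewrite mulr_ge0 ?powR_ge0 ?expR_ge0.
Qed.

End GammaFunction.

(** * The stable law *)

Section StableLaw.
Context {R : realType}.
Variable alpha : R.
Hypotheses (alpha0 : 0 < alpha) (alpha2 : alpha < 2).
Local Notation b := (alpha / 2).
Let b0 : 0 < b. Proof. by rewrite divr_gt0. Qed.
Let b1 : b < 1. Proof. by rewrite ltr_pdivrMr// mul1r. Qed.
Local Notation r := (sibuya_tail b).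

Lemma sibuya_tail_cvg0 : r n @[n --> \oo] --> 0.
Proof.
apply/cvgrPdist_le => e /(sibuya_tail_small b0 b1)[N rN].
exists N => // n /= Nn; rewrite sub0r normrN ger0_norm ?rN//.
exact/ltW/sibuya_tail_gt0.
Qed.

Lemma stable_coef_ge0 n : 0 <= stable_coef alpha n.
Proof. by rewrite mulr_ge0 ?divr_ge0 ?Gamma_ge0// ltW. Qed.

Lemma stable_coefS n : stable_coef alpha n.+2 =
  stable_coef alpha n.+1 * ((n.+1%:R - b) / n.+2%:R).
Proof.
have n1b : 0 < n.+1%:R - b by rewrite subr_gt0 (lt_le_trans b1)// ler1n.
have GnS : Gamma (n.+2%:R - b) = (n.+1%:R - b) * Gamma (n.+1%:R - b).
  by rewrite -Gamma_add1// -natr1 addrAC.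
have GSS : Gamma n.+3%:R = n.+2%:R * Gamma n.+2%:R :> R.
  by rewrite -Gamma_add1 ?ltr0n// natr1.
rewrite /stable_coef GnS GSS invfM; ring.
Qed.

(** Both sides satisfy the recursion that multiplies by
[(n + 1 - b) / (n + 2)]. *)
Lemma stable_coef_sibuya n :
  stable_coef alpha n.+1 = stable_coef alpha 1 / b * (r n - r n.+1).
Proof.
elim: n => [|n IH].
  by rewrite sibuya_tail_sub sibuya_tail0 divr1 mulr1 divfK ?gt_eqF.
have mass : r n.+1 - r n.+2 = (r n - r n.+1) * ((n.+1%:R - b) / n.+2%:R).
  rewrite !sibuya_tail_sub [r n.+1]sibuya_tailS.
  have : n.+1%:R != 0 :> R by rewrite pnatr_eq0.
  have : n.+2%:R != 0 :> R by rewrite pnatr_eq0.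
  move: (n.+1%:R) (n.+2%:R) (r n) b => u v w beta v0 u0.
  by field; rewrite u0 v0.
by rewrite stable_coefS IH mass mulrA.
Qed.

Variable d : nat.
Hypothesis d1 : (1 < d)%N.
Let d0 : (0 < d)%N := ltnW d1.
Local Notation V := 'rV[int]_d.

Lemma stable_law_mixture (z : V) : stable_law alpha z =
  (\sum_(0 <= j <oo)
     (stable_coef alpha j.+1 * iter j.+1 srw_step \1_[set 0] z)%:E)%E.
Proof.
rewrite /stable_law -nneseries_addn.
  by apply: eq_eseriesr => j _; rewrite addn1 convolution_power_srw_law.
move=> j; rewrite lee_fin mulr_ge0 ?stable_coef_ge0//.
by rewrite convolution_power_srw_law//; exact: iter_srw_step_ge0.
Qed.

Lemma stable_law_esum (f : V -> R) x : (forall y, 0 <= f y <= 1) ->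
  \esum_(y in setT) (stable_law alpha y * (f (x + y))%:E)%E =
  (stable_coef alpha 1 / b * stable_operator b f x)%:E.
Proof.
move=> f01; have f0 y : 0 <= f y by case/andP: (f01 y).
under eq_esum => y _ do rewrite stable_law_mixture.
rewrite esum_mixture//; last by move=> j; exact: stable_coef_ge0.
apply/cvg_lim => //; apply: cvg_EFin; first by near=> n; rewrite sumEFin.
rewrite (_ : _ \o _ = fun J => stable_coef alpha 1 / b * stable_step b J f x).
  by apply: cvgM; [exact: cvg_cst|exact: stable_step_cvg].
apply/funext => J; rewrite /= sumEFin /= big_mkord /stable_step mulr_sumr.
by apply: eq_bigr => j _; rewrite stable_coef_sibuya mulrA.
Unshelve. all: by end_near.
Qed.

Lemma stable_operator1 x : stable_operator b (fun _ : V => 1) x = 1.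
Proof.
apply/cvg_lim => //.
rewrite (_ : (fun J => _) = fun J => 1 - r J).
  rewrite -[X in _ --> X]subr0; apply: cvgB; first exact: cvg_cst.
  exact: sibuya_tail_cvg0.
by apply/funext => J; exact: stable_step1.
Qed.

Context {disp : measure_display} {Omega : measurableType disp}.
Context {P : probability Omega R}.
Variable xi : nat -> Omega -> V.
Hypothesis hxi : iid_with_law P (stable_law alpha) xi.

(** The partial sums of the coefficients are proportional to [1 - r J], so their
total is the ratio below, and it is the total mass of the law of an increment. *)
Lemma stable_coef1 : stable_coef alpha 1 / b = 1.
Proof.
have mxi : preimages_measurable (xi 0) by exact: (iid_measurable hxi).
have one01 (y : V) : 0 <= (1 : R) <= 1 by rewrite ler01 lexx.
have := stable_law_esum 0 one01; rewrite stable_operator1 mulr1 => mass.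
apply: EFin_inj; rewrite -mass.
transitivity (P setT); last exact: probability_setT.
rewrite (countable_partition mxi measurableT); apply: eq_esum => y _.
by rewrite /= mule1 setTI (iid_law hxi).
Qed.

Lemma stable_law_operator (f : V -> R) x : (forall y, 0 <= f y <= 1) ->
  \esum_(y in setT) (stable_law alpha y * (f (x + y))%:E)%E =
  (stable_operator b f x)%:E.
Proof. by move=> f01; rewrite stable_law_esum// stable_coef1 mul1r. Qed.

Lemma tube_massive (B : set V) (c : R) (l : 'I_d) : 0 < c ->
  (forall n0, exists n, (n0 <= n)%N /\ forall x : V,
    (forall i, i != l -> ((x 0 i)%:~R : R) ^+ 2 <= c * n%:R ^+ 2) ->
    n%:Z <= x 0 l -> B x) ->
  forall x, P [set w | exists n : nat, B (walk xi x n w)] = 1%E.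
Proof.
move=> c0 top x.
apply: (hitting_probability1 hxi d1 b0 b1 stable_law_operator).
exact: (avoid_tube_cvg0 d1 b0 b1 c0 top).
Qed.

End StableLaw.

(** A real threshold is extracted because the limit superior may be infinite. *)
Lemma limn_esup_gt_frequently {R : realType} (u : R^nat) :
  (0 < limn_esup (EFin \o u))%E ->
  exists2 c : R, 0 < c & forall n0, exists2 n, (n0 <= n)%N & c <= u n.
Proof.
move=> u0; apply: contrapT => H.
suff : (limn_esup (EFin \o u) <= 0)%E by rewrite leNgt u0.
apply/lee_addgt0Pr => e e0; rewrite add0e limn_esup_lim.
have [n0 n0P] : exists n0, forall n, (n0 <= n)%N -> u n <= e.
  apply: contrapT => H'; apply: H; exists e => // n0.
  apply: contrapT => H2; apply: H'; exists n0 => n nn.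
  by rewrite leNgt; apply/negP => /ltW un; apply: H2; exists n.
apply: lime_le; first exact: is_cvg_esups.
exists n0 => // n /= nn; apply: ge_ereal_sup => _ [k /= nk <-].
by rewrite lee_fin n0P// (leq_trans nn).
Qed.

Theorem proposition4p1 (R : realType) (m : nat) (hd : (3 <= m + 1)%N)
  (alpha : R) (halpha0 : 0 < alpha) (halpha2 : alpha < 2)
  (t : nat -> R)
  (ht_pos : forall n : nat, (1 <= n)%N -> 0 < t n)
  (ht_mono : forall n k : nat, (1 <= n)%N -> (n <= k)%N -> t n <= t k)
  (delta : \bar R) (hdelta : (0 < delta)%E)
  (ht_limsup : limn_esup (fun n : nat => (t n / n%:R)%:E) = delta)
  (disp : measure_display) (Omega : measurableType disp)
  (P : probability Omega R) (xi : nat -> Omega -> 'rV[int]_(m + 1))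
  (hxi : iid_with_law P (stable_law alpha) xi) :
  massive P xi (thorn t).
Proof.
split.
  move/seteqP => [_ /(_ 0 I)] [n [n1 n0 _]].
  by move: n0 n1; rewrite !mxE => -[<-].
have [c c0 tc] : exists2 c : R, 0 < c &
    forall n0, exists2 n, (n0 <= n)%N & c <= t n / n%:R.
  by apply: limn_esup_gt_frequently; rewrite (_ : limn_esup _ = delta).
have m0 : (0 < m)%N by rewrite -(ltn_add2r 1) (leq_trans _ hd).
have d1 : (1 < m + 1)%N by exact: leq_trans hd.
(* The cube of half-width [c * n / sqrt m] lies in the ball
   of radius [c * n]. *)
apply: (tube_massive halpha0 halpha2 d1 hxi
  (c := c ^+ 2 / m%:R) (l := rshift m ord0)).
  by rewrite divr_gt0 ?exprn_gt0 ?ltr0n.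
move=> n0; have [n n0n cn] := tc n0.+1; exists n; split; first exact: ltnW.
have n1 : (1 <= n)%N by exact: leq_trans n0n.
have {}cn : c * n%:R <= t n by rewrite -ler_pdivlMr// ltr0n.
move=> x xi_le xl.
have [k xk] : exists k : nat, x 0 (rshift m ord0) = k%:Z.
  by exists (absz (x ord0 (rshift m ord0))); rewrite gez0_abs// (le_trans _ xl).
have nk : (n <= k)%N by rewrite -lez_nat -xk.
exists k; split; first exact: leq_trans nk.
  by rewrite !mxE.
apply: le_trans (ht_mono n k n1 nk).
apply: le_trans cn.
rewrite /euclidean_norm -[leRHS]ger0_norm ?mulr_ge0 ?(ltW c0)// -sqrtr_sqr.
apply: ler_wsqrtr.
apply: (@le_trans _ _ (\sum_(i < m) (c ^+ 2 / m%:R * n%:R ^+ 2))).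
  apply: ler_sum => i _; rewrite mxE; apply: xi_le.
  by rewrite eq_lrshift.
have m0' : m%:R != 0 :> R by rewrite pnatr_eq0 -lt0n.
rewrite sumr_const card_ord -[leLHS]mulr_natr.
by rewrite (_ : _ * m%:R = (c * n%:R) ^+ 2)//; field.
Qed.
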